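(* For every integer $d\geq 1$ there exists a real constant $C_d^{\Box}>0$ (depending only on $d$) such that for every $d$-dimensional lattice simplex $S\subset\mathbb{R}^d$ with lattice width $\operatorname{width}(S)>C_d^{\Box}$, the local $h^*$-polynomial $\ell^*(S;t)=\sum_{k=1}^d\ell_k^*(S)t^k$ has positive coefficients $\ell_1^*(S),\ldots,\ell_d^*(S)$, a simple root at $0$, and $d-1$ distinct negative real roots.
   Context: A $d$-dimensional lattice simplex $S\subset\mathbb{R}^d$ is the convex hull $S=\operatorname{conv}(v_0,\ldots,v_d)$ of $d+1$ affinely independent points $v_0,\ldots,v_d\in\mathbb{Z}^d$. Its local $h^*$-polynomial (also called box polynomial) is the enumerator polynomial, by last coordinate, of the lattice points in its open fundamental parallelepiped: $\ell^*(S;t)=\sum_{k=1}^d\ell_k^*(S)t^k$, where for $1\le k\le d$ $$\ell_k^*(S):=\left|\left\{\sum_{i=0}^d\lambda_i(v_i,1)\;:\;0<\lambda_i<1 \text{ for all } i,\ \sum_{i=0}^d\lambda_i=k\right\}\cap(\mathbb{Z}^d\times\{k\})\right|.$$ The lattice width of a convex body $K\subset\mathbb{R}^d$ is $$\operatorname{width}(K):=\min_{0\ne u\in(\mathbb{Z}^d)^*}\left(\max_{x\in K}u(x)-\min_{x\in K}u(x)\right),$$ where $(\mathbb{Z}^d)^*$ is the set of linear functionals on $\mathbb{R}^d$ taking integer values on $\mathbb{Z}^d$. *)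

(* Defs.v *)
From HB Require Import structures.
From mathcomp Require Import all_boot all_order all_algebra.
From mathcomp Require Import finmap.
From mathcomp Require Import all_classical all_reals all_analysis.

Set Implicit Arguments.
Unset Strict Implicit.
Unset Printing Implicit Defensive.

Import Order.TTheory GRing.Theory Num.Theory.

Local Open Scope classical_set_scope.
Local Open Scope ring_scope.

Section LatticeSimplices.
Context {R : realType} {d : nat}.

Definition lattice_point (z : 'rV[int]_d) : 'rV[R]_d := map_mx intr z.

Definition affinely_independent (n : nat) (p : 'I_n -> 'rV[R]_d) : Prop :=
  forall c : 'I_n -> R,
    \sum_i c i = 0 -> \sum_i c i *: p i = 0 -> forall i, c i = 0.

Definition conv (A : set 'rV[R]_d) : set 'rV[R]_d :=
  smallest (fun K : set 'rV[R]_d => convex_set (K : set (convex_lmodType 'rV[R]_d))) A.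

Definition simplex (v : 'I_d.+1 -> 'rV[int]_d) : set 'rV[R]_d :=
  conv (range (fun i => lattice_point (v i))).

Definition dual_lattice : set {scalar 'rV[R]_d} :=
  [set u | forall z : 'rV[int]_d, u (lattice_point z) \is a Num.int].

(* For a convex body K (nonempty and compact) sup and inf over K are the
   maximum and minimum over K; if moreover d > 0 and K has nonempty interior,
   the infimum over u is attained. *)
Definition width (K : set 'rV[R]_d) : R :=
  inf [set sup [set u x | x in K] - inf [set u x | x in K]
      | u in dual_lattice `&` [set u | exists x, u x != 0]].

(* The slice at height k of the open fundamental parallelepiped of the cone
   over the simplex; (x, a) in R^d x R is row_mx x a%:M. *)
Definition open_parallelepiped_slice (v : 'I_d.+1 -> 'rV[int]_d) (k : nat) :
    set 'rV[R]_(d + 1) :=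
  [set \sum_i lam i *: row_mx (lattice_point (v i)) 1%:M
  | lam in [set lam : 'I_d.+1 -> R |
      (forall i, 0 < lam i < 1) /\ \sum_i lam i = k%:R]].

Definition lattice_points_at_height (k : nat) : set 'rV[R]_(d + 1) :=
  range (fun z : 'rV[int]_d => row_mx (lattice_point z) (k%:R)%:M).

(* The intersection is finite (a bounded set of lattice points), so that
   fset_set does not take its default value fset0. *)
Definition local_hstar_coef (v : 'I_d.+1 -> 'rV[int]_d) (k : nat) : nat :=
  #|` fset_set (open_parallelepiped_slice v k `&` lattice_points_at_height k)|%fset.

Definition local_hstar (v : 'I_d.+1 -> 'rV[int]_d) : {poly R} :=
  \sum_(1 <= k < d.+1) (local_hstar_coef v k)%:R *: 'X^k.

End LatticeSimplices.

Arguments simplex R {d} v.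
Arguments local_hstar_coef R {d} v k.
Arguments local_hstar R {d} v.

(* Main.v *)
Require Import Defs.
From HB Require Import structures.
From mathcomp Require Import all_boot all_order all_algebra.
From mathcomp Require Import finmap.
From mathcomp Require Import complex polyrcf.
From mathcomp Require Import all_classical all_reals all_analysis.
From mathcomp Require Import ring lra zify.

Set Implicit Arguments.
Unset Strict Implicit.
Unset Printing Implicit Defensive.

Import Order.TTheory GRing.Theory Num.Theory.

(** Why the theorem holds.  Write a point of height k of the open
parallelepiped with coefficients l_0, ..., l_d in ]0, 1[, and let
Y_i = l_0 + ... + l_i for i < d.  Reduced modulo 1, the Y_i form a point of the
torus (R/Z)^d, and the lattice condition on the point of the parallelepiped
says that Y B is integral, where B has the rows v_i - v_(i+1).  These Y form a
finite subgroup H of the torus, whose points have denominators dividing det B.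
The closed walk 0, Y_0, ..., Y_(d-1), 0 on the circle moves forward by less
than a full turn at each step, so its winding number k is the number of
descents in [0, 1[ of the walk; hence the coefficient of index k counts the
points of H without stationary step whose walk descends k times
([local_hstar_coef_wrap_class]).

The walls y_i = y_j and y_i = 0 cut the torus into d! chambers of equal volume,
one for each permutation s, and in the chamber of s the walk descends
des(s) + 1 times ([chamber_sub_wrap_class]).  If H is equidistributed, the
polynomial divided by the order of H is therefore close to the Eulerian
polynomial, the sum of t^(des(s) + 1) over all s, divided by d!.  The latter
takes values of alternating signs at d negative points
([eulerian_alternates]); this persists under a small perturbation and yields
d - 1 distinct negative roots by the intermediate value theorem, while all
coefficients of index 1, ..., d remain positive ([wrap_polynomial_roots]).

Equidistribution comes from large width.  A character of the torus that is
trivial on H has a frequency vector B w with w integral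
([edge_group_annihilator]).  Its entries are the differences
w(v_i) - w(v_(i+1)), and when all of them are small, the functional w is nearly
constant on the simplex; for a wide simplex this forces w = 0
([wide_simplex_no_small_annihilator]).  So every nontrivial character of small
frequency sums to 0 over H.  Testing H against products of Fejer kernels, which
are trigonometric polynomials of low degree concentrated near grid points,
gives each chamber its fair share of H ([chamber_discrepancy],
[chamber_equidistribution]). *)

Local Open Scope ring_scope.

(** * Descents and Eulerian polynomials *)

Fixpoint descents (s : seq nat) : nat :=
  if s is x :: s' then
    (if s' is y :: _ then (y < x)%N else false) + descents s'
  else 0.

Lemma descents1 x : descents [:: x] = 0%N. Proof. by []. Qed.

Lemma descents_cons2 x y s :
  descents [:: x, y & s] = ((y < x) + descents (y :: s))%N.
Proof. by []. Qed.

Arguments descents : simpl never.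

Fixpoint insertions (m : nat) (s : seq nat) : seq (seq nat) :=
  if s is x :: s' then (m :: s) :: [seq x :: t | t <- insertions m s']
  else [:: [:: m]].

Lemma descents_nth (s : seq nat) :
  descents s = (\sum_(i < (size s).-1) (nth 0 s i.+1 < nth 0 s i))%N.
Proof.
elim: s => [|x [|y s] IH]; rewrite ?big_ord0 //.
by rewrite descents_cons2 big_ord_recl /= IH.
Qed.

Lemma descents_le_size (x : nat) (s : seq nat) :
  (descents (x :: s) <= size s)%N.
Proof.
elim: s x => [|y s IH] x //; rewrite descents_cons2 /=.
by have := IH y; case: (y < x)%N; lia.
Qed.

(** A letter above all others makes a descent with its right neighbour:
inserted in a descent or at the end it keeps the number of descents, inserted
in an ascent it adds one.  The letter x in front lets the induction see whether
the first insertion place is a descent. *)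
Lemma sum_insertions_cons (V : nmodType) (F : nat -> V) (m x : nat) (s : seq nat) :
  all (gtn m) (x :: s) ->
  \sum_(t <- insertions m s) F (descents (x :: t))
  = F (descents (x :: s)) *+ (descents (x :: s)).+1
    + F (descents (x :: s)).+1 *+ (size s - descents (x :: s)).
Proof.
elim: s x F => [|y s IH] x F /=.
  by rewrite andbT => xm; rewrite big_seq1 descents_cons2 ltnNge (ltnW xm) addr0.
move=> /and3P[xm ym sm].
rewrite big_cons big_map !descents_cons2 ym (ltnNge m x) (ltnW xm) add0n add1n.
under eq_bigr do rewrite descents_cons2.
rewrite (IH y (fun k => F ((y < x) + k)%N)) /= ?ym //.
have := descents_le_size y s; move: (descents (y :: s)) => a le_a.
case: (y < x)%N; rewrite ?add0n ?add1n ?addSn ?addnS.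
  by rewrite subSS addrA -mulrS.
by rewrite subSn // addrCA -mulrS.
Qed.

Lemma sum_insertions (V : nmodType) (F : nat -> V) (m : nat) (s : seq nat) :
  all (gtn m) s ->
  \sum_(t <- insertions m s) F (descents t)
  = F (descents s) *+ (descents s).+1
    + F (descents s).+1 *+ (size s - descents s).
Proof.
case: s => [|x s] ms; first by rewrite big_seq1 addr0.
rewrite /= big_cons big_map sum_insertions_cons // descents_cons2.
have le_s := descents_le_size x s.
case/andP: ms => /= -> _; rewrite add1n subSn //.
by rewrite addrCA -mulrS.
Qed.

Lemma mem_insertions (m : nat) (t : seq nat) :
  m \in t -> t \in insertions m (rem m t).
Proof.
elim: t => [|x t IH] //=; rewrite inE eq_sym.
case: eqP => [-> _|_ /= /IH tm].
  by case: (t) => [|y u] /=; rewrite in_cons eqxx.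
by rewrite in_cons; apply/orP; right; apply: map_f.
Qed.

Lemma size_insertions (m : nat) (s : seq nat) :
  size (insertions m s) = (size s).+1.
Proof. by elim: s => [|x s IH] //=; rewrite size_map IH. Qed.

(** Deleting the letter n shows that every permutation arises by insertion;
since there are (n + 1)! insertions in all, none is repeated. *)
Lemma permutations_recr (n : nat) :
  perm_eq (permutations (iota 0 n.+1))
    (flatten [seq insertions n s | s <- permutations (iota 0 n)]).
Proof.
set L := flatten _.
have sub : {subset permutations (iota 0 n.+1) <= L}.
  move=> t; rewrite mem_permutations => pt.
  have nt : n \in t by rewrite (perm_mem pt) mem_iota; lia.
  apply/flattenP; exists (insertions n (rem n t)); last exact: mem_insertions.
  apply: map_f; rewrite mem_permutations.
  rewrite -(perm_cons n).
  have := perm_to_rem nt; rewrite perm_sym => /perm_trans; apply.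
  move: pt; rewrite -addn1 iotaD => /perm_trans; apply.
  by rewrite perm_catC.
have sizeL : size L = size (permutations (iota 0 n.+1)).
  rewrite size_permutations ?iota_uniq // size_iota size_flatten /shape -map_comp.
  rewrite (_ : map _ _ = map (fun=> n.+1) (permutations (iota 0 n))).
    rewrite sumnE big_map big_const_seq count_predT iter_addn_0.
    by rewrite size_permutations ?iota_uniq // size_iota factS.
  apply/eq_in_map => s; rewrite mem_permutations => /perm_size.
  by rewrite /= size_insertions size_iota => ->.
have le_L : (size L <= size (permutations (iota 0 n.+1)))%N by rewrite sizeL.
apply: uniq_perm; first exact: permutations_uniq.
  exact: leq_size_uniq (permutations_uniq _) sub le_L.
by case: (uniq_min_size (permutations_uniq _) sub le_L).
Qed.

Lemma permutations_iota_gtn (n : nat) (s : seq nat) :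
  s \in permutations (iota 0 n) -> all (gtn n) s /\ size s = n.
Proof.
rewrite mem_permutations => ps; split; last by rewrite (perm_size ps) size_iota.
by apply/allP => x; rewrite (perm_mem ps) mem_iota /=.
Qed.

Lemma descents_permutation_lt (n : nat) (s : seq nat) :
  (0 < n)%N -> s \in permutations (iota 0 n) -> (descents s < n)%N.
Proof.
move=> n_gt0 /permutations_iota_gtn[_ sz].
case: s sz => [|x s] /= sz; first by rewrite -sz in n_gt0.
by rewrite -sz ltnS; exact: descents_le_size.
Qed.

(** The largest letter adds a descent when put in front and none when put at
the end. *)
Lemma exists_permutation_descents (n k : nat) :
  (k < n)%N -> exists2 s, s \in permutations (iota 0 n) & descents s = k.
Proof.
elim: n k => // n IH k; rewrite ltnS => kn.
have recr s t : s \in permutations (iota 0 n) -> t \in insertions n s ->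
    t \in permutations (iota 0 n.+1).
  move=> ps ts; rewrite (perm_mem (permutations_recr n)).
  by apply/flattenP; exists (insertions n s) => //; apply: map_f.
case: n => [|n] in IH kn recr *; first by exists [:: 0%N] => //; case: k kn.
case: k => [|k] in kn *.
  have [s ps d0] := IH 0%N isT.
  have [/allP lt_s _] := permutations_iota_gtn ps.
  exists (rcons s n.+1).
    apply: (recr s) => //; elim: (s) => [|x u IHu] //=; rewrite inE ?eqxx //.
    by rewrite map_f ?orbT.
  elim: s lt_s d0 {ps} => [|x [|y s] IHs] // lt_s.
    rewrite /= descents_cons2 descents1 => _.
    by have := lt_s x; rewrite inE eqxx => /(_ isT) /= xn; rewrite ltnNge ltnW.
  rewrite /= ![descents [:: x, y & _]]descents_cons2 => /eqP.
  rewrite addn_eq0 => /andP[/eqP-> /eqP d0]; rewrite add0n.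
  by apply: IHs => // z zs; apply: lt_s; rewrite inE zs orbT.
have [s ps ds] := IH k kn.
have [lt_s sz] := permutations_iota_gtn ps.
exists (n.+1 :: s).
  by apply: (recr s) => //; case: (s) => [|x u] /=; rewrite inE eqxx.
case: s sz lt_s ds {ps} => [|x s] //= _ /andP[/= xn _].
by rewrite descents_cons2 xn => ->.
Qed.

Section Eulerian.
Variable R : rcfType.

(** If A(t) is the sum of t^(des + 1), this is A(t) / (1 - t)^(n + 1) in the
variable u = 1 / (1 - t).  In this variable the operator t d/dt becomes
u (u - 1) d/du and the half-line t < 0 becomes the interval ]0, 1[, so that a
rational function on an unbounded domain is replaced by a polynomial on a
bounded one. *)
Definition eulerian_fraction (n : nat) : {poly R} :=
  \sum_(s <- permutations (iota 0 n))
     ('X - 1) ^+ (descents s).+1 * 'X ^+ (n - descents s).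

(** Differentiating the factor ('X - 1) ^+ (des + 1) accounts for the
insertions of the new letter that keep the number of descents, differentiating
the power of 'X for those that increase it. *)
Lemma eulerian_fraction_recr (n : nat) : (0 < n)%N ->
  eulerian_fraction n.+1 = 'X * ('X - 1) * (eulerian_fraction n)^`().
Proof.
move=> n_gt0.
rewrite /eulerian_fraction (perm_big _ (permutations_recr n)) /=.
rewrite big_flatten big_map raddf_sum mulr_sumr /= big_seq [RHS]big_seq.
apply: eq_bigr => s ps.
have [lt_s sz] := permutations_iota_gtn ps.
rewrite (sum_insertions (fun k => ('X - 1) ^+ k.+1 * 'X ^+ (n.+1 - k))) // sz.
have := descents_permutation_lt n_gt0 ps.
move: (descents s) => a lt_a.
have [b nE] : exists b, n = (a + b.+1)%N by exists (n - a).-1; lia.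
have -> : (n - a = b.+1)%N by lia.
have -> : (n.+1 - a = b.+2)%N by lia.
have -> : (n.+1 - a.+1 = b.+1)%N by lia.
rewrite derivM deriv_exp derivXn derivB derivX derivC subr0 /=.
rewrite mul1r !exprS.
ring.
Qed.

Lemma eulerian_fraction_bounds (n : nat) : (0 < n)%N ->
  (eulerian_fraction n).[0] = 0 /\ (eulerian_fraction n).[1] = 0.
Proof.
move=> n_gt0; split; rewrite /eulerian_fraction horner_sum big_seq big1 // => s ps.
  have lt_s := descents_permutation_lt n_gt0 ps.
  by rewrite !hornerE expr0n subn_eq0 leqNgt lt_s /= mulr0.
by rewrite !hornerE subrr expr0n /= mul0r.
Qed.

(** Rolle's argument, keeping track of signs: together with its zeros at 0
and 1, the n alternating values of the polynomial make it rise and fall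
alternately on n + 1 consecutive intervals, and the mean value theorem gives
n + 1 points where the derivative alternates in sign.  The factor u (u - 1) of
the recurrence has constant sign on ]0, 1[. *)
Lemma eulerian_fraction_alternates (n : nat) : (0 < n)%N ->
  exists u : nat -> R,
    [/\ forall i, (i < n)%N -> 0 < u i < 1,
        forall i, (i.+1 < n)%N -> u i.+1 < u i
      & forall i, (i < n)%N -> 0 < (-1) ^+ i.+1 * (eulerian_fraction n).[u i]].
Proof.
case: n => // n _; elim: n => [|n [u [u01 u_decr u_sign]]].
  exists (fun=> 1 / 2); split=> // i; first by move=> _; lra.
  rewrite ltnS leqn0 => /eqP->.
  rewrite /eulerian_fraction big_seq1 subn0 descents1 !expr1 -polyC1.
  by rewrite hornerM hornerXsubC hornerX; lra.
set Q := eulerian_fraction n.+1 in u_sign *.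
have [Q0 Q1] : Q.[0] = 0 /\ Q.[1] = 0 by exact: eulerian_fraction_bounds.
(* The points u framed by the two zeros: x_0 = 1 and x_(n+2) = 0. *)
pose x i := if i is j.+1 then if (j < n.+1)%N then u j else 0 else 1.
have x_decr i : (i < n.+2)%N -> x i.+1 < x i.
  rewrite /x; case: i => [|i] lt_i.
    by have /andP[] := u01 0%N isT.
  rewrite ltnS in lt_i; rewrite lt_i.
  by case: ltnP => [/u_decr //|_]; have /andP[] := u01 i lt_i.
have Qx_step i : (i < n.+2)%N -> 0 < (-1) ^+ i * (Q.[x i] - Q.[x i.+1]).
  have Qx_ge0 j : (j <= n.+2)%N -> 0 <= (-1) ^+ j * Q.[x j].
    rewrite /x; case: j => [|j] _; first by rewrite Q1 mulr0.
    by case: ltnP => [/u_sign /ltW //|_]; rewrite Q0 mulr0.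
  have Qx_gt0 j : (0 < j < n.+2)%N -> 0 < (-1) ^+ j * Q.[x j].
    by case: j => // j /=; rewrite ltnS => lt_j; rewrite lt_j; exact: u_sign.
  move=> lt_i; have -> : (-1) ^+ i * (Q.[x i] - Q.[x i.+1])
      = (-1) ^+ i * Q.[x i] + (-1) ^+ i.+1 * Q.[x i.+1] by rewrite exprS; ring.
  case: i => [|i] in lt_i *.
    by apply: ltr_wpDl; [exact: Qx_ge0 | exact: Qx_gt0].
  by apply: ltr_pwDl; [exact: Qx_gt0 | exact: Qx_ge0].
have cE i : exists c, (i < n.+2)%N ->
    x i.+1 < c < x i /\ 0 < (-1) ^+ i * Q^`().[c].
  case: (ltnP i n.+2) => [lt_i|_]; last by exists 0.
  have [c /itvP c_in Qc] := mvt Q (x_decr i lt_i).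
  exists c => _; split; first by rewrite !c_in.
  have := Qx_step i lt_i; rewrite Qc mulrA pmulr_lgt0 //.
  by rewrite subr_gt0 x_decr.
have [c cP] := choice cE.
exists c; split=> i lt_i.
- have [/andP[lo hi] _] := cP i lt_i.
  apply/andP; split.
    apply: le_lt_trans lo; rewrite /x /=.
    by case: ltnP => // /u01 /andP[/ltW].
  apply: lt_le_trans hi _; rewrite /x; case: i lt_i {lo} => // i.
  by rewrite ltnS => lt_i; rewrite lt_i; have /andP[_ /ltW] := u01 i lt_i.
- have [/andP[_ hi] _] := cP i.+1 lt_i.
  have [/andP[lo _] _] := cP i (ltnW lt_i).
  exact: lt_trans hi lo.
- have [/andP[lo hi] sgn] := cP i lt_i.
  have c_gt0 : 0 < c i.
    apply: le_lt_trans lo; rewrite /x /=.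
    by case: ltnP => // /u01 /andP[/ltW].
  have c_lt1 : c i < 1.
    apply: lt_le_trans hi _; rewrite /x; case: i lt_i {sgn c_gt0 lo} => // i.
    by rewrite ltnS => lt_i; rewrite lt_i; have /andP[_ /ltW] := u01 i lt_i.
  rewrite eulerian_fraction_recr // -/Q -polyC1 !hornerM hornerX hornerXsubC exprS.
  have -> : -1 * (-1) ^+ i * (c i * (c i - 1) * Q^`().[c i])
      = (c i * (1 - c i)) * ((-1) ^+ i * Q^`().[c i]) by ring.
  by apply: mulr_gt0 => //; apply: mulr_gt0 => //; rewrite subr_gt0.
Qed.

(** The previous lemma at t = 1 - 1 / u. *)
Lemma eulerian_alternates (n : nat) : (0 < n)%N ->
  exists t : nat -> R,
    [/\ forall i, (i < n)%N -> t i < 0,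
        forall i, (i.+1 < n)%N -> t i.+1 < t i
      & forall i, (i < n)%N -> 0 < (-1) ^+ i.+1 *
          \sum_(s <- permutations (iota 0 n)) t i ^+ (descents s).+1].
Proof.
move=> n_gt0; have [u [u01 u_decr u_sign]] := eulerian_fraction_alternates n_gt0.
exists (fun i => 1 - (u i)^-1); split=> i lt_i.
- by have /andP[u0 u1] := u01 i lt_i; rewrite subr_lt0 invf_gt1.
- have /andP[u0 _] := u01 i.+1 lt_i; have /andP[u0' _] := u01 i (ltnW lt_i).
  by rewrite ltrD2l ltrN2 ltf_pV2 ?posrE // u_decr.
have /andP[u0 _] := u01 i lt_i; have u_neq0 := lt0r_neq0 u0.
have := u_sign i lt_i.
rewrite -(pmulr_lgt0 _ (x := u i ^- n.+1)) ?invr_gt0 ?exprn_gt0 // -mulrA.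
congr (_ < _ * _); rewrite /eulerian_fraction horner_sum mulr_suml.
rewrite big_seq [RHS]big_seq; apply: eq_bigr => s ps.
have le_s := ltnW (descents_permutation_lt n_gt0 ps).
rewrite !hornerE.
have -> : n.+1 = ((descents s).+1 + (n - descents s))%N by lia.
rewrite exprD; move: (n - _)%N (descents s).+1 => a b.
rewrite invfM mulrACA divff ?expf_neq0 // mulr1.
by rewrite -exprVn -exprMn; congr (_ ^+ _); field.
Qed.

End Eulerian.

(** * Characters of the circle *)

Section Characters.
Variable R : realType.
Implicit Types x y : R.

Definition circle x : R[i] := (cos (2 * pi * x) +i* sin (2 * pi * x))%C.

Lemma circleD x y : circle (x + y) = circle x * circle y.
Proof.
rewrite /circle mulrDr cosD sinD; apply/eqP; rewrite eq_complex /=.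
by apply/andP; split; apply/eqP; ring.
Qed.

Lemma circle0 : circle 0 = 1.
Proof. by rewrite /circle mulr0 cos0 sin0. Qed.

Lemma circle_conj x : (circle x)^* = circle (- x).
Proof. by rewrite /circle mulrN cosN sinN. Qed.

Lemma circle_neq0 x : circle x != 0.
Proof.
apply/eqP => c0; have := circleD x (- x).
by rewrite c0 mul0r subrr circle0 => /eqP; rewrite oner_eq0.
Qed.

Lemma circleN x : circle (- x) = (circle x)^-1.
Proof.
apply: (mulfI (circle_neq0 x)).
by rewrite -circleD subrr circle0 divff ?circle_neq0.
Qed.

Lemma norm_circle x : `|circle x| = 1.
Proof.
apply/eqP; rewrite -(@eqrXn2 _ 2) // normCK circle_conj -circleD subrr circle0.
by rewrite expr1n.
Qed.

Lemma circle_sum (I : finType) (P : pred I) (F : I -> R) :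
  circle (\sum_(i | P i) F i) = \prod_(i | P i) circle (F i).
Proof. exact: (big_morph _ circleD circle0). Qed.

Lemma circle_natmul x n : circle (n%:R * x) = circle x ^+ n.
Proof.
elim: n => [|n IH]; first by rewrite mul0r circle0 expr0.
by rewrite -[n.+1]addn1 natrD mulrDl mul1r circleD IH exprD expr1.
Qed.

Lemma circle_nat n : circle n%:R = 1.
Proof.
rewrite -[n%:R]mulr1 circle_natmul /circle mulr1 mulr_natl cos2pi sin2pi.
exact: expr1n.
Qed.

Lemma circle_int (k : int) : circle k%:~R = 1.
Proof.
case: k => k; first by rewrite -pmulrn circle_nat.
by rewrite NegzE rmorphN /= circleN -pmulrn circle_nat invr1.
Qed.

Lemma norm_circle_sub1 x :
  `|circle x - 1| ^+ 2 = (2 - 2 * cos (2 * pi * x))%:C%C.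
Proof.
rewrite normCK rmorphB rmorph1 /= circle_conj.
rewrite mulrBl mulrBr -circleD subrr circle0 mul1r mulr1.
rewrite /circle mulrN cosN sinN; apply/eqP; rewrite eq_complex /=.
by apply/andP; split; apply/eqP; ring.
Qed.

(** The squared length of the chord from 1 to [circle delta]. *)
Definition circle_gap (delta : R) : R := 2 - 2 * cos (2 * pi * delta).

Lemma circle_gap_gt0 delta : 0 < delta <= 1 / 2 -> 0 < circle_gap delta.
Proof.
move=> /andP[d0 d1]; have pi0 := pi_gt0 R.
suff : cos (2 * pi * delta) < cos (0 : R) by rewrite cos0 /circle_gap; lra.
rewrite ltr_cos ?in_itv /= ?lexx ?(ltW pi0) //.
  by rewrite !mulr_gt0.
rewrite !mulr_ge0 ?(ltW pi0) ?(ltW d0) //=.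
by rewrite mulrAC ler_piMl ?(ltW pi0) //; lra.
Qed.

Lemma circle_gap_le delta x : 0 < delta <= 1 / 2 -> delta <= `|x| <= 1 - delta ->
  (circle_gap delta)%:C%C <= `|circle x - 1| ^+ 2.
Proof.
have pi0 := pi_gt0 R.
have abs_le z : 0 < delta <= 1 / 2 -> delta <= z <= 1 / 2 ->
    cos (2 * pi * z) <= cos (2 * pi * delta).
  move=> /andP[d0 d1] /andP[dz z1].
  have in_pi (t : R) : 0 < t <= 1 / 2 -> 2 * pi * t \in `[0, pi].
    move=> /andP[t0 t1]; rewrite in_itv /= !mulr_ge0 ?(ltW pi0) ?(ltW t0) //=.
    by have := ler_wpM2l (ltW pi0) t1; lra.
  rewrite leNgt ltr_cos ?in_pi ?d0 ?(lt_le_trans d0 dz) //.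
  by rewrite -leNgt ler_pM2l // mulr_gt0.
move=> d01 /andP[dx x1]; rewrite norm_circle_sub1 lecR lerD2l lerN2 ler_pM2l //.
have -> : cos (2 * pi * x) = cos (2 * pi * `|x|).
  by case: (ger0P x) => // _; rewrite mulrN cosN.
have [x2|x2] := leP `|x| (1 / 2); first by apply: abs_le; rewrite ?dx.
have -> : cos (2 * pi * `|x|) = cos (2 * pi * (1 - `|x|)).
  by rewrite -[LHS]cosN -[LHS]cosD2pi; congr cos; rewrite -mulr_natl; ring.
by apply: abs_le => //; lra.
Qed.

(** A remainder r strictly between 0 and m + 1 would leave a gap between 1 and
the value at r / (m + 1). *)
Lemma circle_dvd (m : nat) (k : int) :
  circle (k%:~R / m.+1%:R) = 1 -> (m.+1 %| k)%Z.
Proof.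
move=> c1; apply/dvdz_mod0P; move: c1; rewrite {1}(divz_eq k m.+1).
have r_ge0 := modz_ge0 k (d := m.+1) isT; have := ltz_pmod k (d := m.+1) isT.
case: (k %% _)%Z r_ge0 => // r _ r_lt.
rewrite rmorphD rmorphM /= mulrDl mulfK ?pnatr_eq0 // circleD circle_int mul1r.
case: (posnP r) => [-> //|r_gt0 c1].
have m0 : (0 : R) < m.+1%:R by rewrite ltr0n.
have : (0 : R) < r%:R / m.+1%:R by rewrite divr_gt0 ?ltr0n.
have : r%:R / m.+1%:R < 1 :> R by rewrite ltr_pdivrMr // mul1r ltr_nat.
move: c1; rewrite -pmulrn; set x : R := r%:R / _ => c1 x1 x0.
have d01 : 0 < Num.min x (1 - x) <= 1 / 2.
  rewrite lt_min x0 subr_gt0 x1 ge_min /=.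
  by clearbody x; case: (leP x (1 / 2)) => //= ?; lra.
have := circle_gap_le (x := x) d01.
rewrite ger0_norm ?(ltW x0) // ge_min lexx /=.
rewrite c1 subrr normr0 expr0n /= lecR => H.
have := circle_gap_gt0 d01; rewrite ltNge H //.
by rewrite lerBrDr -lerBrDl ge_min lexx orbT.
Qed.

Lemma sum_circle (m : nat) (k : int) :
  \sum_(q < m.+1) circle (k%:~R * (q%:R / m.+1%:R))
    = (if (m.+1 %| k)%Z then m.+1%:R else 0).
Proof.
pose z := circle (k%:~R / m.+1%:R).
have E (q : 'I_m.+1) : circle (k%:~R * (q%:R / m.+1%:R)) = z ^+ q.
  by rewrite -circle_natmul mulrCA.
under eq_bigr do rewrite E; case: ifPn => [/dvdzP[c kE]|nk].
  rewrite (_ : z = 1); last first.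
    by rewrite /z -(circle_int c) kE rmorphM /= -pmulrn mulfK ?pnatr_eq0.
  by under eq_bigr do rewrite expr1n; rewrite sumr_const card_ord.
have z1 : z - 1 != 0 by rewrite subr_eq0; apply: contra nk => /eqP/circle_dvd.
apply: (mulfI z1); rewrite -subrX1 mulr0 -circle_natmul mulrC divfK ?pnatr_eq0 //.
by rewrite circle_int subrr.
Qed.

End Characters.

(** * Fejer kernels summed over a finite subgroup of the torus *)

Section Fejer.
Variable R : realType.
Implicit Types x y : R.

(** The Fejer kernel, normalised so that its translates by the multiples of
1 / D form a partition of unity. *)
Definition fejer (D : nat) x : R[i] :=
  (D%:R ^+ 2)^-1 * `|\sum_(j < D) circle (j%:R * x)| ^+ 2.

Lemma fejer_ge0 D x : 0 <= fejer D x.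
Proof. by rewrite mulr_ge0 ?invr_ge0 ?exprn_ge0. Qed.

Lemma fejerE D x :
  fejer D x = (D%:R ^+ 2)^-1 *
    \sum_(p : 'I_D * 'I_D) circle (((p.1 : int) - (p.2 : int))%:~R * x).
Proof.
congr (_ * _); rewrite normCK rmorph_sum /= big_distrlr /=.
rewrite pair_bigA; apply: eq_bigr => -[j k] _ /=.
by rewrite circle_conj -circleD -mulrBl rmorphB.
Qed.

(** A geometric sum: |z - 1| times |1 + z + ... + z^(D-1)| is |z^D - 1|,
which is at most 2. *)
Lemma fejer_le D x (c : R[i]) : 0 < c -> c <= `|circle x - 1| ^+ 2 ->
  fejer D x <= 4 / (c * D%:R ^+ 2).
Proof.
move=> c_gt0 c_le; case: D => [|D].
  by rewrite /fejer big_ord0 normr0 expr0n /= !mulr0 invr0 mulr0.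
rewrite invfM mulrA [leRHS]mulrC /fejer ler_pM2l ?invr_gt0 ?exprn_gt0 ?ltr0n //.
rewrite ler_pdivlMr // mulrC.
apply: (@le_trans _ _ (`|circle x - 1| ^+ 2 * `|\sum_(j < D.+1) circle (j%:R * x)| ^+ 2)).
  by rewrite ler_wpM2r ?exprn_ge0.
under eq_bigr do rewrite circle_natmul.
rewrite -exprMn -normrM -subrX1 -circle_natmul.
rewrite (_ : 4 = 2 ^+ 2); last by rewrite -natrX.
rewrite lerXn2r ?nnegrE //.
by apply: le_trans (ler_normB _ _) _; rewrite norm_circle normr1.
Qed.

(** Summing over the grid keeps only the frequencies divisible by D + 1, and
the only such frequency of the kernel is 0. *)
Lemma fejer_sum (D : nat) x : \sum_(q < D.+1) fejer D.+1 (x - q%:R / D.+1%:R) = 1.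
Proof.
under eq_bigr do rewrite fejerE.
rewrite -mulr_sumr exchange_big /=.
under eq_bigr => p _.
  under eq_bigr => q _ do rewrite mulrBr circleD -mulNr -rmorphN.
  rewrite -mulr_sumr sum_circle dvdzE abszN -dvdzE.
  over.
rewrite -(pair_bigA _ (fun p1 p2 : 'I_D.+1 => circle (((p1 : int) - (p2 : int))%:~R * x) *
    (if (D.+1 %| (p1 : int) - (p2 : int))%Z then D.+1%:R else 0))) /=.
under eq_bigr => p1 _.
  rewrite (bigD1 p1) //= subrr dvdz0 mul0r circle0 mul1r big1 ?addr0; last first.
    move=> p2 p12; case: ifP; last by rewrite mulr0.
    move=> dv; suff: p2 = p1 by move/eqP: p12.
    apply/val_inj => /=; move: dv (ltn_ord p1) (ltn_ord p2).
    case/dvdzP => c; case: (ltgtP c 0) => [c_lt0|c_gt0|->]; nia.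
  over.
by rewrite sumr_const card_ord -[X in _ * X]mulr_natr -expr2 mulVf // expf_neq0 ?pnatr_eq0.
Qed.

(** Translation by h permutes H and multiplies the sum by the value of the
character at h, which is not 1. *)
Lemma sum_character (d m : nat) (H : {set {ffun 'I_d -> 'I_m.+1}})
    (n : 'I_d -> int) :
  zmod_closed H ->
  (exists2 h, h \in H & ~~ (m.+1 %| \sum_i n i * (h i : int))%Z) ->
  \sum_(g in H) circle (\sum_i (n i)%:~R * ((g i)%:R / m.+1%:R) : R) = 0.
Proof.
move=> [H0 HB] [h hH nt].
pose chi (g : {ffun 'I_d -> 'I_m.+1}) :=
  circle (\sum_i (n i)%:~R * ((g i)%:R / m.+1%:R) : R).
have HN g : g \in H -> - g \in H by move=> gH; rewrite -sub0r HB.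
have HD g g' : g \in H -> g' \in H -> g + g' \in H.
  by move=> gH gH'; rewrite -[g']opprK HB ?HN.
have chiD g : chi (g + h) = chi g * chi h.
  rewrite /chi -circleD -big_split /= !circle_sum; apply: eq_bigr => i _.
  rewrite -mulrDr -mulrDl -natrD ffunE /= [in RHS](divn_eq (g i + h i) m.+1).
  rewrite natrD natrM mulrDl mulrDr circleD mulfK ?pnatr_eq0 //.
  by rewrite [X in _ = circle (_ * X) * _]pmulrn -rmorphM circle_int mul1r.
have chi_h : chi h != 1.
  apply: contra nt => /eqP; rewrite /chi => c1; apply: (@circle_dvd R).
  rewrite -[RHS]c1 rmorph_sum /= mulr_suml; congr circle; apply: eq_bigr => i _.
  by rewrite rmorphM /= -pmulrn mulrA.
have E : \sum_(g in H) chi g = (\sum_(g in H) chi g) * chi h.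
  rewrite mulr_suml [LHS](reindex_inj (addIr h)) /=.
  apply: eq_big => [g|g _]; last exact: chiD.
  apply/idP/idP => [gh|/HD]; last exact.
  by rewrite -(addrK h g) HB.
apply/eqP; move/eqP: E; rewrite -subr_eq0 -[X in X - _]mulr1 -mulrBr mulf_eq0.
by rewrite subr_eq0 [1 == _]eq_sym (negPf chi_h) orbF.
Qed.

(** The integer vectors n that pair to 0 modulo m + 1 with all of H are the
frequencies of the characters of the torus that are trivial on H. *)
Definition no_small_annihilator (d m D : nat) (H : {set {ffun 'I_d -> 'I_m.+1}}) :
    Prop :=
  forall n : 'I_d -> int, (forall i, `|n i| < D%:Z) -> (exists i, n i != 0) ->
    exists2 h, h \in H & ~~ (m.+1 %| \sum_i n i * (h i : int))%Z.

(** Expanding the product gives characters whose frequencies are differences of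
exponents at most D; those of nonzero frequency sum to 0 over H, and
(D + 1)^d choices of exponents have frequency 0. *)
Lemma sum_fejer (d m D : nat) (H : {set {ffun 'I_d -> 'I_m.+1}})
    (x : 'I_d -> R) :
  zmod_closed H ->
  no_small_annihilator D.+1 H ->
  \sum_(g in H) \prod_i fejer D.+1 ((g i)%:R / m.+1%:R - x i)
    = #|H|%:R / D.+1%:R ^+ d.
Proof.
move=> Hsub Hnt.
under eq_bigr do (under eq_bigr do rewrite fejerE).
under eq_bigr do rewrite big_split /= bigA_distr_bigA /=.
rewrite -mulr_sumr exchange_big /=.
have -> : \sum_(f : {ffun 'I_d -> 'I_D.+1 * 'I_D.+1})
    \sum_(g in H) \prod_i circle ((((f i).1 : int) - ((f i).2 : int))%:~R *
       ((g i)%:R / m.+1%:R - x i))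
  = \sum_(f : {ffun 'I_d -> 'I_D.+1 * 'I_D.+1})
     \prod_i ((f i).1 == (f i).2)%:R * #|H|%:R.
  apply: eq_bigr => f _.
  pose n i := ((f i).1 : int) - ((f i).2 : int).
  have [/existsP[i0 fi0]|] := boolP [exists i, (f i).1 != (f i).2].
    rewrite [in RHS](bigD1 i0) //= (negPf fi0) !mul0r.
    under eq_bigr do rewrite -circle_sum.
    under eq_bigr => g _.
      under eq_bigr do rewrite mulrBr.
      rewrite sumrB circleD.
      over.
    rewrite -mulr_suml (@sum_character _ _ _ n) ?mul0r //.
    apply: Hnt => [i|].
      by rewrite /n; have := ltn_ord (f i).1; have := ltn_ord (f i).2; lia.
    exists i0; apply: contra fi0; rewrite /n subr_eq0 => /eqP[n0].
    by apply/eqP/val_inj.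
  rewrite negb_exists => /forallP f12.
  rewrite [in RHS]big1 ?mul1r; last by move=> i _; have := f12 i; rewrite negbK => ->.
  rewrite -[in RHS]sum1_card natr_sum; apply: eq_bigr => g _.
  by rewrite big1 // => i _; have := f12 i; rewrite negbK => /eqP->;
     rewrite subrr mul0r circle0.
rewrite -mulr_suml.
rewrite -(bigA_distr_bigA (fun (i : 'I_d) (p : 'I_D.+1 * 'I_D.+1) => (p.1 == p.2)%:R)).
have -> : \sum_(p : 'I_D.+1 * 'I_D.+1) (p.1 == p.2)%:R = D.+1%:R :> R[i].
  rewrite -(pair_bigA _ (fun p1 p2 : 'I_D.+1 => (p1 == p2)%:R)) /=.
  under eq_bigr => p1 _.
    rewrite (bigD1 p1) //= eqxx big1 ?addr0; last first.
      by move=> p2; rewrite eq_sym => /negPf->.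
    over.
  by rewrite sumr_const card_ord.
rewrite !prodr_const card_ord mulrA [RHS]mulrC; congr (_ * _).
rewrite -exprMn -[RHS]exprVn; congr (_ ^+ d).
by rewrite expr2 ?invfM mulfVK ?pnatr_eq0.
Qed.

End Fejer.

(** * Order chambers of the torus *)

(** The order type of f, a permutation of 0, ..., d - 1 when f is injective. *)
Definition rank_word (d : nat) (f : 'I_d -> nat) : seq nat :=
  [seq #|[set j | (f j < f i)%N]| | i <- enum 'I_d].

Lemma size_rank_word (d : nat) (f : 'I_d -> nat) : size (rank_word f) = d.
Proof. by rewrite size_map size_enum_ord. Qed.

Lemma nth_rank_word (d : nat) (f : 'I_d -> nat) (i : 'I_d) :
  nth 0%N (rank_word f) i = #|[set j | (f j < f i)%N]|.
Proof. by rewrite (nth_map i) ?size_enum_ord // nth_ord_enum. Qed.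

Lemma rank_word_lt (d : nat) (f : 'I_d -> nat) (i j : 'I_d) :
  (nth 0 (rank_word f) i < nth 0 (rank_word f) j)%N = (f i < f j)%N.
Proof.
rewrite !nth_rank_word; case: (ltnP (f i) (f j)) => fij.
  apply/proper_card/properP; split; last by exists i; rewrite !inE ?ltnn.
  by apply/fintype.subsetP => k; rewrite !inE => /ltn_trans; apply.
apply/negbTE; rewrite -leqNgt; apply/subset_leq_card/fintype.subsetP => k.
by rewrite !inE => /leq_trans; apply.
Qed.

Lemma permutations_iota_nth (d : nat) (s : seq nat) (k : nat) :
  s \in permutations (iota 0 d) -> (k < d)%N ->
  exists i : 'I_d, nth 0%N s i = k.
Proof.
rewrite mem_permutations => ps lt_k.
have ks : k \in s by rewrite (perm_mem ps) mem_iota.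
have lt_i : (index k s < d)%N by rewrite -[d](size_iota 0) -(perm_size ps) index_mem.
by exists (Ordinal lt_i); rewrite /= nth_index.
Qed.

Lemma permutations_iota_inj (d : nat) (s : seq nat) (i j : 'I_d) :
  s \in permutations (iota 0 d) -> nth 0%N s i = nth 0%N s j -> i = j.
Proof.
rewrite mem_permutations => ps /eqP.
rewrite nth_uniq ?(perm_size ps) ?size_iota ?(perm_uniq ps) ?iota_uniq //.
by move=> /eqP /val_inj.
Qed.

(** A letter of a permutation is the number of letters below it. *)
Lemma rank_wordP (d : nat) (f : 'I_d -> nat) (s : seq nat) :
  s \in permutations (iota 0 d) ->
  (forall i j : 'I_d, (nth 0 s i < nth 0 s j)%N -> (f i < f j)%N) ->
  rank_word f = s.
Proof.
move=> ps mono; have [lt_s sz] := permutations_iota_gtn ps.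
apply: (@eq_from_nth _ 0%N); rewrite size_rank_word // => i lt_i.
rewrite (_ : i = Ordinal lt_i :> nat) // nth_rank_word; move: (Ordinal lt_i) => {lt_i}i.
have mono' j k : (f j < f k)%N = (nth 0 s j < nth 0 s k)%N.
  apply/idP/idP; last exact: mono.
  apply: contraLR; rewrite -!leqNgt leq_eqVlt.
  by move=> /orP[/eqP/esym/(permutations_iota_inj ps)-> //|/mono/ltnW].
transitivity #|[set j : 'I_d | (j < nth 0 s i)%N]|; last first.
  have le_i : (nth 0 s i <= d)%N.
    by apply: ltnW; apply: (allP lt_s); rewrite mem_nth // sz.
  have [->|/prednK E] := posnP (nth 0 s i).
    by apply: eq_card0 => j; rewrite !inE.
  have w_inj : injective (widen_ord le_i) by move=> j k [] /val_inj.
  rewrite -[RHS](card_ord (nth 0 s i)) -[RHS](card_imset predT w_inj).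
  apply: eq_card => j; rewrite !inE; apply/idP/imsetP => [lt_j|[k _ ->]] //=.
  by exists (Ordinal lt_j) => //; apply: val_inj.
have nth_lt (j : 'I_d) : (nth 0 s j < d)%N by apply: (allP lt_s); rewrite mem_nth // sz.
pose p j := Ordinal (nth_lt j).
have p_inj : injective p by move=> j k [] /(permutations_iota_inj ps).
rewrite -(card_imset _ p_inj); apply: eq_card => j; rewrite !inE.
apply/imsetP/idP => [[k]|lt_j].
  by rewrite inE mono' => lt_k ->.
have [k kE] := permutations_iota_nth ps (ltn_ord j).
exists k; first by rewrite inE mono' kE.
by apply: val_inj; rewrite /= kE.
Qed.

(** The points of H in a chamber cut out by the walls y_i = y_j and y_i = 0. *)
Definition chamber (d m : nat) (H : {set {ffun 'I_d -> 'I_m.+1}}) (s : seq nat) :=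
  [set y : {ffun 'I_d -> 'I_m.+1} in H |
    (rank_word (fun i => y i : nat) == s) && [forall i, (0 < y i)%N]].

(** The points of the grid of mesh 1 / (D + 1) that lie in the chamber of s, at
distance at least L / (D + 1) from the walls. *)
Definition spread_grid (d D L : nat) (s : seq nat) : {set {ffun 'I_d -> 'I_D.+1}} :=
  [set q : {ffun 'I_d -> 'I_D.+1} | [forall i, (L <= q i)%N && (q i + L <= D)%N] &&
     [forall i : 'I_d, forall j : 'I_d, (nth 0 s i < nth 0 s j)%N ==> (q i + L <= q j)%N]].

(** Increasing d-tuples below (n - d - 1) L become such grid points once the
k-th value is shifted by (k + 1) L and the values are arranged in the order
of s. *)
Lemma card_spread_grid (d D L n : nat) (s : seq nat) :
  s \in permutations (iota 0 d) -> (D.+1 = n * L)%N -> (d < n)%N ->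
  ('C((n - d.+1) * L, d) <= #|spread_grid d D L s|)%N.
Proof.
move=> ps DE dn; set M := ((n - d.+1) * L)%N.
have [lt_s sz] := permutations_iota_gtn ps.
have s_lt (i : 'I_d) : (nth 0 s i < d)%N by apply: (allP lt_s); rewrite mem_nth // sz.
rewrite -card_ltn_sorted_tuples.
have L_gt0 : (0 < L)%N by case: L DE {M} => //; rewrite muln0.
pose val_q (t : d.-tuple 'I_M) (i : 'I_d) : nat :=
  (nth 0%N (map val t) (nth 0 s i) + (nth 0 s i).+1 * L)%N.
have t_lt (t : d.-tuple 'I_M) k : (k < d)%N -> (nth 0%N (map val t) k < M)%N.
  move=> kd; have : nth 0%N (map val t) k \in map val t.
    by rewrite mem_nth // size_map size_tuple.
  by move=> /mapP[x _ ->]; exact: ltn_ord.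
have val_q_le t i : (val_q t i + L <= D)%N.
  have lt1 := t_lt t _ (s_lt i); have lt2 := s_lt i.
  have : ((nth 0 s i).+1 * L <= d * L)%N by rewrite leq_mul2r lt2 orbT.
  have ME : (M + d.+1 * L = D.+1)%N by rewrite DE /M -mulnDl subnK.
  rewrite /val_q; move: ME; rewrite mulSn; lia.
pose q (t : d.-tuple 'I_M) : {ffun 'I_d -> 'I_D.+1} := [ffun i => inord (val_q t i)].
have qE t i : q t i = val_q t i :> nat.
  by rewrite ffunE inordK // ltnS (leq_trans _ (val_q_le t i)) // leq_addr.
have q_inj : injective q.
  move=> t t' /ffunP qq; apply: val_inj; apply: (inj_map val_inj).
  apply: (@eq_from_nth _ 0%N); rewrite !size_map !size_tuple // => k lt_k.
  have [i iE] := permutations_iota_nth ps lt_k.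
  have := congr1 val (qq i); rewrite /= !qE /val_q iE => /eqP.
  by rewrite eqn_add2r => /eqP.
rewrite -(card_imset _ q_inj); apply/subset_leq_card/fintype.subsetP => _ /imsetP[t + ->].
rewrite !inE => sorted_t; apply/andP; split.
  apply/forallP => i; rewrite qE val_q_le andbT /val_q mulSn addnCA; exact: leq_addr.
apply/forallP => i; apply/forallP => j; apply/implyP => sij.
have le_t : (nth 0 (map val t) (nth 0 s i) <= nth 0 (map val t) (nth 0 s j))%N.
  by rewrite ltnW // (sorted_ltn_nth ltn_trans) // ?inE ?size_map ?size_tuple.
have : ((nth 0 s i).+2 * L <= (nth 0 s j).+1 * L)%N by rewrite leq_mul2r ltnS sij orbT.
by rewrite mulSnr !qE /val_q -addnA; exact: leq_add.
Qed.

(** The margin L / (D + 1) = 1 / n is twice 1 / (2n): a point all of whose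
coordinates are within 1 / (2n) of those of q has its coordinates in the same
order as q and away from 0.  The margin also keeps the coordinates of q away
from 0 and 1, which gives the upper bound, that is, a distance measured around
the circle. *)
Lemma spread_grid_close (R : realType) (d D L n m : nat) (s : seq nat)
    (H : {set {ffun 'I_d -> 'I_m.+1}})
    (q : {ffun 'I_d -> 'I_D.+1}) (g : {ffun 'I_d -> 'I_m.+1}) :
  s \in permutations (iota 0 d) -> (D.+1 = n * L)%N ->
  q \in spread_grid d D L s -> g \in H :\: chamber H s ->
  exists i, 1 / (2 * n%:R) <= `|(g i)%:R / m.+1%:R - (q i)%:R / D.+1%:R : R|
            <= 1 - 1 / (2 * n%:R).
Proof.
move=> ps DE; rewrite !inE => /andP[/forallP qL /forallP q_mono] /andP[g_ch gH].
have L_gt0 : (0 < L)%N by case: L DE {qL q_mono} => //; rewrite muln0.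
have n_gt0 : (0 < n)%N by case: n DE.
set delta : R := 1 / (2 * n%:R).
have nR : (0 : R) < n%:R by rewrite ltr0n.
have mR : (0 : R) < m.+1%:R by rewrite ltr0n.
have DR : (0 : R) < D.+1%:R by rewrite ltr0n.
have delta_gt0 : 0 < delta by rewrite divr_gt0 // mulr_gt0.
have LE : L%:R / D.+1%:R = 2 * delta.
  rewrite DE natrM /delta; field.
  by rewrite !pnatr_eq0 -!lt0n L_gt0 n_gt0.
apply/existsP; apply: contraNT g_ch; rewrite gH /= negb_exists => /forallP far.
pose x i : R := (g i)%:R / m.+1%:R; pose y i : R := (q i)%:R / D.+1%:R.
have x0 i : 0 <= x i by rewrite divr_ge0.
have x1 i : x i < 1 by rewrite ltr_pdivrMr // mul1r ltr_nat.
have y0 i : 2 * delta <= y i.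
  by rewrite -LE ler_pM2r ?invr_gt0 // ler_nat; case/andP: (qL i).
have y1 i : y i + 2 * delta < 1.
  rewrite -LE -mulrDl -natrD ltr_pdivrMr // mul1r ltr_nat ltnS.
  by case/andP: (qL i).
have y_mono (i j : 'I_d) : (nth 0 s i < nth 0 s j)%N -> y i + 2 * delta <= y j.
  move=> sij; rewrite -LE -mulrDl -natrD ler_pM2r ?invr_gt0 // ler_nat.
  by have /forallP /(_ j) /implyP := q_mono i; apply.
have g_lt (i j : 'I_d) : x i < x j -> (g i < g j)%N.
  by rewrite ltr_pM2r ?invr_gt0 // ltr_nat.
have g_gt0 i : 0 < x i -> (0 < g i)%N by rewrite pmulr_lgt0 ?invr_gt0 // ltr0n.
have {}far i : ~~ (delta <= `|x i - y i| <= 1 - delta) by exact: far.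
clearbody x y delta.
have close i : y i - delta < x i < y i + delta.
  have := far i; rewrite negb_and -!ltNge.
  move: (x i) (y i) (x0 i) (x1 i) (y0 i) (y1 i) => a b a0 a1 b0 b1.
  by case: (ger0P (a - b)) => ab /orP[]; lra.
apply/andP; split.
  apply/eqP/rank_wordP => // i j /y_mono yij; apply: g_lt.
  by have := close i; have := close j; lra.
by apply/forallP => i; apply: g_gt0; have := close i; have := y0 i; lra.
Qed.

(** The kernels of the other coordinates sum to 1 over the grid. *)
Lemma sum_fejer_slice (R : realType) (d D : nat) (x : 'I_d -> R) (i : 'I_d)
    (P : pred 'I_D.+1) :
  \sum_(q : {ffun 'I_d -> 'I_D.+1} | P (q i))
     \prod_j fejer D.+1 (x j - (q j)%:R / D.+1%:R)
  = \sum_(r | P r) fejer D.+1 (x i - r%:R / D.+1%:R).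
Proof.
pose F j (r : 'I_D.+1) := (if j == i then (P r)%:R else 1) *
  fejer D.+1 (x j - r%:R / D.+1%:R).
transitivity (\sum_(q : {ffun 'I_d -> 'I_D.+1}) \prod_j F j (q j)).
  rewrite big_mkcond; apply: eq_bigr => q _.
  have -> : \prod_j F j (q j) = (P (q i))%:R *
      \prod_j fejer D.+1 (x j - (q j)%:R / D.+1%:R).
    rewrite /F big_split /=; congr (_ * _).
    by rewrite (bigD1 i) //= eqxx big1 ?mulr1 // => j /negPf->.
  by case: (P (q i)); rewrite ?mul1r ?mul0r.
rewrite -bigA_distr_bigA (bigD1 i) //= [X in _ * X]big1 ?mulr1 => [|j /negPf ji].
  rewrite [RHS]big_mkcond /=; apply: eq_bigr => r _; rewrite /F eqxx.
  by case: (P r); rewrite ?mul1r ?mul0r.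
by rewrite -[RHS](fejer_sum D (x j)); apply: eq_bigr => r _; rewrite /F ji mul1r.
Qed.

(** Spread each point g of H over the grid with the product of Fejer kernels
around g as weights.  In total, each grid point receives #|H| / (D + 1)^d.  What
the grid points deep inside the chamber receive is at most 1 from each point of
the chamber, and little from any other point of H, since some coordinate is then
far away. *)
Lemma chamber_discrepancy (R : realType) (d D L n m : nat) (s : seq nat)
    (H : {set {ffun 'I_d -> 'I_m.+1}}) :
  s \in permutations (iota 0 d) -> (D.+1 = n * L)%N ->
  zmod_closed H ->
  no_small_annihilator D.+1 H ->
  #|H|%:R * #|spread_grid d D L s|%:R / D.+1%:R ^+ d
    <= #|chamber H s|%:R
       + #|H|%:R * (d%:R * (4 / (circle_gap (1 / (2 * n%:R)) * D.+1%:R))) :> R.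
Proof.
move=> ps DE Hsub Hnt; set A := spread_grid d D L s.
set delta : R := 1 / (2 * n%:R).
have n_gt0 : (0 < n)%N by case: n DE {delta}.
have d01 : 0 < delta <= 1 / 2.
  rewrite divr_gt0 ?mulr_gt0 ?ltr0n //= ler_pdivrMr ?mulr_gt0 ?ltr0n //.
  by rewrite mulrA mul1r mulVf // mul1r ler1n.
have gap_gt0 := circle_gap_gt0 d01; set c := circle_gap delta in gap_gt0 *.
set eta : R := d%:R * (4 / (c * D.+1%:R)).
pose W (q : {ffun 'I_d -> 'I_D.+1}) (g : {ffun 'I_d -> 'I_m.+1}) :=
  \prod_i fejer D.+1 ((g i)%:R / m.+1%:R - (q i)%:R / D.+1%:R : R).
have W_ge0 q g : 0 <= W q g by apply: prodr_ge0 => i _; exact: fejer_ge0.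
have W_sum1 g : \sum_(q in A) W q g <= 1.
  rewrite -[leRHS](_ : \sum_q W q g = 1); last first.
    rewrite /W -(bigA_distr_bigA (fun i (r : 'I_D.+1) =>
      fejer D.+1 ((g i)%:R / m.+1%:R - r%:R / D.+1%:R))) big1 // => i _.
    exact: fejer_sum.
  by rewrite [leRHS](bigID (mem A)) /= lerDl sumr_ge0.
have W_far g : g \in H :\: chamber H s -> \sum_(q in A) W q g <= eta%:C%C.
  move=> gH.
  pose far (i : 'I_d) (r : 'I_D.+1) :=
    delta <= `|(g i)%:R / m.+1%:R - r%:R / D.+1%:R : R| <= 1 - delta.
  apply: (@le_trans _ _ (\sum_i \sum_(q : {ffun 'I_d -> 'I_D.+1} | far i (q i)) W q g)).
    rewrite (exchange_big_dep predT) //= big_mkcond /=; apply: ler_sum => q _.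
    case: ifP => qA; last by apply: sumr_ge0.
    have [i far_i] := spread_grid_close R ps DE qA gH.
    by rewrite (bigD1 i) //= lerDl sumr_ge0.
  rewrite /eta rmorphM /= rmorph_nat mulr_natl -[in leRHS](card_ord d) -sumr_const.
  apply: ler_sum => i _; rewrite sum_fejer_slice.
  apply: (@le_trans _ _ (\sum_(r < D.+1) 4 / (c%:C%C * D.+1%:R ^+ 2))).
    rewrite big_mkcond /=; apply: ler_sum => r _; case: ifP => [far_r|_].
      by apply: fejer_le; [rewrite ltcR | exact: circle_gap_le].
    by rewrite divr_ge0 // mulr_ge0 ?lecR ?(ltW gap_gt0) // exprn_ge0.
  rewrite sumr_const card_ord le_eqVlt; apply/orP; left; apply/eqP.
  rewrite fmorph_div rmorphM !rmorph_nat /= -mulr_natr.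
  have c0 : c%:C%C != 0 by rewrite eq_complex /= eqxx andbT lt0r_neq0.
  by field; rewrite nat1r pnatr_eq0 c0.
have eta_ge0 : 0 <= eta by rewrite /eta mulr_ge0 // divr_ge0 // mulr_ge0 // ltW.
clearbody eta.
rewrite -lecR rmorphD !rmorphM fmorphV rmorphXn !rmorph_nat /=.
have -> : #|H|%:R * #|A|%:R / D.+1%:R ^+ d = \sum_(q in A) \sum_(g in H) W q g.
  under eq_bigr do rewrite sum_fejer //.
  by rewrite sumr_const -[RHS]mulr_natr mulrAC.
rewrite exchange_big /= (bigID (mem (chamber H s))) /=.
apply: lerD.
  apply: (@le_trans _ _ (\sum_(g in chamber H s) 1)); last by rewrite sumr_const.
  rewrite (eq_bigl (mem (chamber H s))) => [|g]; last first.
    by rewrite !inE; case: (g \in H).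
  by apply: ler_sum => g _; exact: W_sum1.
apply: (@le_trans _ _ (\sum_(g in H) eta%:C%C)); last by rewrite sumr_const mulr_natl.
rewrite [leLHS]big_mkcondr /=; apply: ler_sum => g gH; case: ifP => g_ch.
  by apply: W_far; rewrite inE g_ch.
by rewrite lecR.
Qed.

(** * Equidistribution among the order chambers *)

Lemma expn_leq_ffact (M d : nat) : ((M - d) ^ d <= M ^_ d)%N.
Proof.
elim: d M => [|d IH] M //; case: M => [|M]; first by rewrite exp0n.
rewrite ffactSS subSS expnS leq_mul //; first by rewrite (leq_trans (leq_subr _ _)).
Qed.

(** Bernoulli's inequality. *)
Lemma bernoulli_subr (R : realDomainType) (a : R) (d : nat) :
  0 <= a <= 1 -> 1 - d%:R * a <= (1 - a) ^+ d.
Proof.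
move=> /andP[a0 a1]; elim: d => [|d IH]; first by rewrite mul0r subr0 expr0.
rewrite exprS; apply: (@le_trans _ _ ((1 - a) * (1 - d%:R * a))).
  have : 0 <= d%:R * a * a by rewrite !mulr_ge0.
  by rewrite -[d.+1]addn1 natrD; lra.
by rewrite ler_wpM2l // subr_ge0.
Qed.

(** As n grows, the margin becomes negligible and the density tends to 1 / d!,
the volume of the chamber. *)
Lemma density_spread_grid (R : realFieldType) (d D L n : nat) (s : seq nat) :
  s \in permutations (iota 0 d) -> (D.+1 = n * L)%N -> (d.*2 < n)%N ->
  (d`!)%:R^-1 * (1 - d%:R * (d.*2.+1%:R / n%:R))
    <= #|spread_grid d D L s|%:R / D.+1%:R ^+ d :> R.
Proof.
move=> ps DE dn; set M := ((n - d.+1) * L)%N.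
have L_gt0 : (0 < L)%N by case: L DE {M} => //; rewrite muln0.
have le_A : (((n - d.*2.+1) * L) ^ d <= #|spread_grid d D L s| * d`!)%N.
  apply: (@leq_trans ('C(M, d) * d`!)); last first.
    by rewrite leq_mul2r (card_spread_grid ps DE) ?orbT; lia.
  rewrite bin_ffact; apply: leq_trans (expn_leq_ffact _ _).
  case: (posnP d) => [->|d0]; first by rewrite !expn0.
  rewrite leq_exp2r // leq_subRL; last by rewrite /M; nia.
  by rewrite /M; nia.
have n0 : (0 : R) < n%:R by rewrite ltr0n; lia.
have f0 : (0 : R) < (d`!)%:R by rewrite ltr0n fact_gt0.
have D0 : (0 : R) < D.+1%:R by rewrite ltr0n.
rewrite [leLHS]mulrC ler_pdivrMr // mulrAC -natrM.
rewrite ler_pdivlMr ?exprn_gt0 //.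
apply: (@le_trans _ _ (((n - d.*2.+1) * L)%N%:R ^+ d)); last by rewrite -natrX ler_nat.
rewrite DE !natrM natrB // !exprMn [leLHS]mulrA ler_pM2r ?exprn_gt0 ?ltr0n //.
have -> : n%:R - d.*2.+1%:R = (1 - d.*2.+1%:R / n%:R) * n%:R :> R.
  by rewrite mulrBl mul1r mulfVK // lt0r_neq0.
rewrite exprMn ler_pM2r ?exprn_gt0 //; apply: bernoulli_subr.
by rewrite divr_ge0 //= ler_pdivrMr // mul1r ler_nat.
Qed.

(** First n is chosen, to make the margin of the grid points small in volume;
this fixes the distance at which the kernels are estimated.  Then the grid is
refined, through L, until the kernels are small at that distance. *)
Lemma chamber_equidistribution (R : realType) (d : nat) (eps : R) : 0 < eps ->
  exists D : nat, forall (m : nat) (H : {set {ffun 'I_d -> 'I_m.+1}}),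
    zmod_closed H ->
    no_small_annihilator D.+1 H ->
    forall s, s \in permutations (iota 0 d) ->
      #|H|%:R * ((d`!)%:R^-1 - eps) <= #|chamber H s|%:R :> R.
Proof.
move=> eps0.
have archi (x : R) : exists k : nat, x < k.+1%:R.
  exists (Num.truncn x); exact: truncnS_gt.
have [n0 n0P] := archi (d%:R * d.*2.+1%:R * 2 / eps).
pose n := (n0 + d.*2).+1.
set c := circle_gap (1 / (2 * n%:R) : R).
have c_gt0 : 0 < c.
  apply: circle_gap_gt0; rewrite divr_gt0 ?mulr_gt0 ?ltr0n //=.
  by rewrite ler_pdivrMr ?mulr_gt0 ?ltr0n // mulrA mul1r mulVf // mul1r ler1n.
have [l lP] := archi (d%:R * 4 * 2 / (c * eps)).
pose D := (n * l.+1).-1; have DE : (D.+1 = n * l.+1)%N by rewrite prednK.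
exists D => m H Hsub Hnt s ps.
have disc := chamber_discrepancy R ps DE Hsub Hnt; rewrite -/c in disc.
have dn : (d.*2 < n)%N by rewrite /n; lia.
have dens := density_spread_grid R ps DE dn.
have nR : (0 : R) < n%:R by rewrite ltr0n.
have DR : (0 : R) < D.+1%:R by rewrite ltr0n.
have small1 : (d`!)%:R^-1 * (d%:R * (d.*2.+1%:R / n%:R)) <= eps / 2.
  apply: (@le_trans _ _ (d%:R * (d.*2.+1%:R / n%:R))).
    rewrite ler_piMl ?mulr_ge0 ?divr_ge0 //.
    by rewrite invf_le1 ?ltr0n ?fact_gt0 // ler1n fact_gt0.
  rewrite mulrA ler_pdivrMr // -ler_pdivrMl ?divr_gt0 //.
  rewrite mulrC invf_div mulrA; apply: le_trans (ltW n0P) _.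
  by rewrite ler_nat /n; lia.
have small2 : d%:R * (4 / (c * D.+1%:R)) <= eps / 2.
  rewrite mulrA ler_pdivrMr ?mulr_gt0 // mulrA -ler_pdivrMl ?mulr_gt0 ?divr_gt0 //.
  apply: (@le_trans _ _ (l.+1%:R)).
    apply: le_trans (ltW lP); rewrite le_eqVlt; apply/orP; left; apply/eqP.
    by field; rewrite !lt0r_neq0.
  by rewrite ler_nat DE leq_pmull.
rewrite -mulrA in disc.
move: dens disc small1 small2; rewrite mulrBr mulr1.
set A : R := _ / D.+1%:R ^+ d; set e : R := d%:R * (4 / _).
set f : R := (d`!)%:R^-1 * (_ * _); clearbody A e f => dens disc small1 small2.
have H0 : (0 : R) <= #|H|%:R by [].
have : #|H|%:R * ((d`!)%:R^-1 - eps) + #|H|%:R * e <= #|H|%:R * A.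
  by rewrite -mulrDr ler_wpM2l //; lra.
by lra.
Qed.

(** * Wrap numbers and the roots of their generating polynomial *)

(** The closed walk 0, y_0, ..., y_(d-1), 0; the default value
of [nth] provides its end. *)
Definition corner (d m : nat) (y : {ffun 'I_d -> 'I_m.+1}) (i : nat) : nat :=
  nth 0%N (0%N :: [seq (y j : nat) | j <- enum 'I_d]) i.

Lemma cornerS (d m : nat) (y : {ffun 'I_d -> 'I_m.+1}) (i : 'I_d) :
  corner y i.+1 = y i.
Proof. by rewrite /corner /= (nth_map i) ?size_enum_ord // nth_ord_enum. Qed.

Lemma corner_last (d m : nat) (y : {ffun 'I_d -> 'I_m.+1}) : corner y d.+1 = 0%N.
Proof. by rewrite /corner /= nth_default // size_map size_enum_ord. Qed.

Lemma corner_le (d m : nat) (y : {ffun 'I_d -> 'I_m.+1}) i : (corner y i <= m)%N.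
Proof.
case: i => [//|i]; case: (ltnP i d) => [lt_i|ge_i].
  by rewrite (cornerS y (Ordinal lt_i)) -ltnS.
by rewrite /corner /= nth_default // size_map size_enum_ord.
Qed.

(** A step of a walk that moves forward on the circle by less than a full turn
passes the origin exactly when its representative in 0, ..., m decreases, so
this is the winding number of the walk. *)
Definition wraps (d m : nat) (y : {ffun 'I_d -> 'I_m.+1}) : nat :=
  \sum_(i < d.+1) (corner y i.+1 < corner y i)%N.

(** The walks without stationary step of winding number k. *)
Definition wrap_class (d m : nat) (H : {set {ffun 'I_d -> 'I_m.+1}}) (k : nat) :=
  [set y in H | [forall i : 'I_d.+1, corner y i.+1 != corner y i] && (wraps y == k)].

(** Between y_0 and y_(d-1) the walk descends where s does; its first step goes
up from 0 and its last step descends to 0. *)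
Lemma chamber_sub_wrap_class (d m : nat) (H : {set {ffun 'I_d -> 'I_m.+1}}) (s : seq nat) :
  (0 < d)%N -> s \in permutations (iota 0 d) ->
  chamber H s \subset wrap_class H (descents s).+1.
Proof.
case: d H => // d H _ ps; apply/fintype.subsetP => y.
rewrite !inE => /and3P[-> /eqP rank_y /forallP y_gt0] /=.
have [_ sz] := permutations_iota_gtn ps.
have mono (i j : 'I_d.+1) : (y i < y j)%N = (nth 0 s i < nth 0 s j)%N.
  by rewrite -rank_y (rank_word_lt (fun i => y i : nat)).
have cornerN (i : 'I_d) : (corner y i.+2 < corner y i.+1)%N
    = (nth 0 s i.+1 < nth 0 s i)%N.
  rewrite (cornerS y (lift ord0 i)) (cornerS y (widen_ord (leqnSn d) i)).
  exact: mono.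
have y_inj (i j : 'I_d.+1) : y i = y j :> nat -> i = j.
  move=> yij; apply: (permutations_iota_inj ps).
  by case: (ltngtP (nth 0 s i) (nth 0 s j)) => //; rewrite -mono yij ltnn.
apply/andP; split.
  apply/forallP => -[[|i] lt_i] /=; first by rewrite (cornerS y ord0) -lt0n y_gt0.
  have lt_i' : (i < d.+1)%N by [].
  rewrite (cornerS y (Ordinal lt_i')).
  case: (ltnP i.+1 d.+1) => [lt_id|ge_id].
    rewrite (cornerS y (Ordinal lt_id)).
    by apply/eqP => /y_inj[] /esym/n_Sn.
  have -> : i.+2 = d.+2 by lia.
  by rewrite corner_last eq_sym -lt0n.
rewrite /wraps big_ord_recl big_ord_recr /= corner_last (cornerS y ord_max) y_gt0.
rewrite add0n addn1 eqSS descents_nth sz /=; apply/eqP/eq_bigr => i _.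
by rewrite -cornerN.
Qed.

Lemma sum_card_chamber (d m : nat) (H B : {set {ffun 'I_d -> 'I_m.+1}})
    (r : seq (seq nat)) (P : pred (seq nat)) :
  uniq r -> (forall s, s \in r -> P s -> chamber H s \subset B) ->
  (\sum_(s <- r | P s) #|chamber H s| <= #|B|)%N.
Proof.
move=> r_uniq sub.
apply: (@leq_trans (\sum_(s <- r | P s) \sum_(y in B) (y \in chamber H s))).
  rewrite big_seq_cond [leqRHS]big_seq_cond; apply: leq_sum => s /andP[sr Ps].
  rewrite -sum1_card [leqRHS]big_mkcond [leqLHS]big_mkcond; apply: leq_sum => y _.
  by case: ifP => // /(fintype.subsetP (sub s sr Ps)) ->.
rewrite exchange_big /= -sum1_card; apply: leq_sum => y _.
apply: (@leq_trans (count_mem (rank_word (fun i => y i : nat)) r)).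
  rewrite -sum1_count big_mkcond [leqRHS]big_mkcond; apply: leq_sum => s _.
  case: ifP => // _; rewrite !inE eq_sym /=; case: (_ == _) => /=.
    exact: leq_b1.
  by rewrite andbF.
by rewrite count_uniq_mem // leq_b1.
Qed.

Definition eulerian (d k : nat) : nat :=
  count (fun s => (descents s).+1 == k) (permutations (iota 0 d)).

(** The chambers are disjoint and there are d! of them, so the lower bounds for
the chambers outside the wrap class bound the wrap class from above. *)
Lemma card_wrap_class_approx (R : realFieldType) (d m : nat)
    (H : {set {ffun 'I_d -> 'I_m.+1}}) (eps : R) (k : nat) :
  (0 < d)%N -> 0 <= eps ->
  (forall s, s \in permutations (iota 0 d) ->
     #|H|%:R * ((d`!)%:R^-1 - eps) <= #|chamber H s|%:R) ->
  `|#|wrap_class H k|%:R - #|H|%:R * ((eulerian d k)%:R / (d`!)%:R)|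
    <= #|H|%:R * ((d`!)%:R * eps).
Proof.
move=> d_gt0 eps_ge0 lower.
pose r := permutations (iota 0 d).
have r_uniq : uniq r by exact: permutations_uniq.
have size_r : size r = d`! by rewrite size_permutations ?iota_uniq // size_iota.
have f_neq0 : (d`!)%:R != 0 :> R by rewrite pnatr_eq0 -lt0n fact_gt0.
have sum_lower (P : pred (seq nat)) :
    (count P r)%:R * (#|H|%:R * ((d`!)%:R^-1 - eps))
      <= (\sum_(s <- r | P s) #|chamber H s|)%N%:R.
  rewrite natr_sum mulr_natl -iter_addr_0 -big_const_seq.
  by rewrite big_seq_cond [leRHS]big_seq_cond ler_sum // => s /andP[sr _]; exact: lower.
pose P s := (descents s).+1 == k.
have sum_in : (\sum_(s <- r | P s) #|chamber H s| <= #|wrap_class H k|)%N.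
  by apply: sum_card_chamber => // s sr /eqP <-; exact: chamber_sub_wrap_class.
have sum_out : (\sum_(s <- r | predC P s) #|chamber H s| <= #|H :\: wrap_class H k|)%N.
  apply: sum_card_chamber => // s sr Ps; apply/fintype.subsetP => y yc.
  have := fintype.subsetP (chamber_sub_wrap_class H d_gt0 sr) y yc.
  by rewrite !inE => /and3P[-> -> /eqP->]; move: Ps => /=; rewrite /P => /negPf->.
have HE : (#|wrap_class H k| + #|H :\: wrap_class H k| = #|H|)%N.
  rewrite -[RHS](cardsID (wrap_class H k)); congr (#|pred_of_set _| + _)%N.
  by apply/setP => y; rewrite !inE; case: (y \in H).
have countE : (eulerian d k + count (predC P) r = d`!)%N.
  by rewrite -size_r -(count_predC P).
have low_in : (eulerian d k)%:R * (#|H|%:R * ((d`!)%:R^-1 - eps)) <= #|wrap_class H k|%:R.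
  by apply: (le_trans (sum_lower P)); rewrite ler_nat.
have low_out : (count (predC P) r)%:R * (#|H|%:R * ((d`!)%:R^-1 - eps))
    <= #|H :\: wrap_class H k|%:R.
  by apply: (le_trans (sum_lower (predC P))); rewrite ler_nat.
move/(congr1 (fun n => n%:R : R)): HE; rewrite natrD.
move/(congr1 (fun n => n%:R : R)): countE; rewrite natrD.
have : (0 : R) <= (eulerian d k)%:R by [].
have : (0 : R) <= (count (predC P) r)%:R by [].
have : (0 : R) <= #|H|%:R by [].
move: low_in low_out f_neq0; rewrite ler_norml.
move: (#|wrap_class H k|%:R : R) (#|H :\: wrap_class H k|%:R : R) (#|H|%:R : R) => S T N.
move: ((eulerian d k)%:R : R) ((count (predC P) r)%:R : R) ((d`!)%:R : R) => a b F.
move=> low_in low_out F0 N0 b0 a0 FE NE.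
have Ne0 : 0 <= N * eps by rewrite mulr_ge0.
have := mulr_ge0 a0 Ne0; have := mulr_ge0 b0 Ne0.
have E1 : a * (N * (F^-1 - eps)) = N * (a / F) - a * (N * eps) by ring.
have E2 : b * (N * (F^-1 - eps)) = N - N * (a / F) - b * (N * eps).
  by rewrite -FE; field; rewrite FE.
have E3 : N * (F * eps) = a * (N * eps) + b * (N * eps) by rewrite -FE; ring.
by lra.
Qed.

Lemma sum_eulerian (R : pzRingType) (d : nat) (t : R) : (0 < d)%N ->
  \sum_(s <- permutations (iota 0 d)) t ^+ (descents s).+1
  = \sum_(1 <= k < d.+1) (eulerian d k)%:R * t ^+ k.
Proof.
move=> d_gt0; transitivity (\sum_(s <- permutations (iota 0 d))
    \sum_(1 <= k < d.+1) ((descents s).+1 == k)%:R * t ^+ k).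
  rewrite big_seq [RHS]big_seq; apply: eq_bigr => s ps.
  have lt_s := descents_permutation_lt d_gt0 ps.
  rewrite (bigD1_seq (descents s).+1) ?iota_uniq ?mem_index_iota ?ltnS //= eqxx mul1r.
  by rewrite big1 ?addr0 // => k; rewrite eq_sym => /negPf->; rewrite mul0r.
rewrite exchange_big /=; apply: eq_bigr => k _.
rewrite -mulr_suml -natr_sum /eulerian -sum1_count [in RHS]big_mkcond /=.
by congr (_%:R * _); apply: eq_bigr => s _; case: eqP.
Qed.

(** One root in each interval between consecutive points. *)
Lemma alternating_roots (R : rcfType) (p : {poly R}) (n : nat) (t : nat -> R) :
  (forall i, (i < n)%N -> t i.+1 < t i) ->
  (forall i, (i <= n)%N -> 0 < (-1) ^+ i.+1 * p.[t i]) ->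
  exists rs : seq R, [/\ size rs = n, uniq rs
    & forall x, x \in rs -> x < t 0%N /\ root p x].
Proof.
move=> t_decr t_sign.
have rootE i : exists x : R, (i < n)%N -> t i.+1 < x < t i /\ root p x.
  case: (ltnP i n) => [lt_i|_]; last by exists 0.
  have sgn : p.[t i.+1] * p.[t i] < 0.
    have := mulr_gt0 (t_sign i.+1 lt_i) (t_sign i (ltnW lt_i)).
    rewrite [(-1) ^+ i.+2]exprS; set e := (-1) ^+ i.+1.
    have -> : -1 * e * p.[t i.+1] * (e * p.[t i])
        = - (e ^+ 2 * (p.[t i.+1] * p.[t i])) by ring.
    by rewrite sqrr_sign mul1r oppr_gt0.
  have [x /itvP x_in px] := poly_ivtoo (ltW (t_decr i lt_i)) sgn.
  by exists x => _; rewrite !x_in.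
have [c cP] := choice rootE.
have t_le i j : (i <= j <= n)%N -> t j <= t i.
  case/andP; elim: j => [|j IH]; first by rewrite leqn0 => /eqP->.
  rewrite leq_eqVlt => /orP[/eqP-> //|ij] jn.
  by apply: (le_trans (ltW (t_decr j jn))); apply: IH => //; exact: ltnW.
have c_decr i j : (i < j < n)%N -> c j < c i.
  move=> /andP[ij jn]; have [/andP[_ cj] _] := cP j jn.
  have [/andP[ci _] _] := cP i (ltn_trans ij jn).
  by apply: (lt_trans cj); apply: le_lt_trans ci; apply: t_le; rewrite ij ltnW.
exists (mkseq c n); split; first by rewrite size_mkseq.
  apply/mkseq_uniqP => i j; rewrite !inE => lt_i lt_j cij.
  by case: (ltngtP i j) => // ij; have := c_decr _ _ (introT andP (conj ij _));
     [rewrite cij ltxx => /(_ lt_j) | rewrite cij ltxx => /(_ lt_i)].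
move=> x /(nthP 0)[j]; rewrite size_mkseq => lt_j; rewrite nth_mkseq // => <-.
have [/andP[_ ci] ->] := cP j lt_j; split=> //.
by apply: (lt_le_trans ci); apply: t_le; rewrite leq0n ltnW.
Qed.

Lemma mup0_eq1 (F : fieldType) (p : {poly F}) (n : nat) (c : nat -> F) :
  (0 < n)%N -> c 1%N != 0 -> p = \sum_(1 <= k < n.+1) c k *: 'X^k ->
  mup 0 p = 1%N.
Proof.
move=> n_gt0 c1 ->.
have -> : \sum_(1 <= k < n.+1) c k *: 'X^k
    = ('X - 0%:P) ^+ 1 * \sum_(0 <= k < n) c k.+1 *: 'X^k :> {poly F}.
  rewrite big_add1 /= subr0 expr1 mulr_sumr; apply: eq_bigr => k _.
  by rewrite -scalerAr -exprS.
rewrite mupMl ?mup_XsubCX ?eqxx //.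
rewrite rootE horner_sum -(prednK n_gt0) big_nat_recl //= hornerZ expr0 hornerC mulr1.
by rewrite big1 ?addr0 // => k _; rewrite hornerZ hornerXn expr0n mulr0.
Qed.

Lemma exists_small_multiplier (R : realFieldType) (n : nat) (c e : nat -> R) (b : R) :
  0 < b -> (forall i, (i < n)%N -> 0 < e i) ->
  exists2 eps : R, 0 < eps < b & forall i, (i < n)%N -> eps * `|c i| < e i.
Proof.
move=> b0; elim: n => [|n IH] e_gt0; first by exists (b / 2) => //; lra.
have [i lt_i|eps /andP[eps0 eps_b] epsP] := IH; first by apply: e_gt0; rewrite ltnW.
have en := e_gt0 n (leqnn _); have cn : 0 < `|c n| + 1 by rewrite ltr_wpDl.
exists (Num.min eps (e n / (`|c n| + 1))).
  by rewrite lt_min eps0 divr_gt0 //= gt_min eps_b.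
move=> i; rewrite ltnS leq_eqVlt => /orP[/eqP->|/epsP].
  apply: (@le_lt_trans _ _ (e n / (`|c n| + 1) * `|c n|)).
    by rewrite ler_wpM2r // ge_min lexx orbT.
  by rewrite mulrAC ltr_pdivrMr // ltr_pM2l // ltrDl.
by apply: le_lt_trans; rewrite ler_wpM2r // ge_min lexx.
Qed.

(** The polynomial divided by #|H| has coefficients close to those of the
Eulerian polynomial divided by d!.  The precision needed depends only on d: it
must preserve the signs at the alternation points and leave every chamber
occupied, so that all coefficients are positive. *)
Lemma wrap_polynomial_roots (R : realType) (d : nat) : (0 < d)%N ->
  exists D : nat, forall (m : nat) (H : {set {ffun 'I_d -> 'I_m.+1}}),
    zmod_closed H ->
    no_small_annihilator D.+1 H ->
    let p : {poly R} := \sum_(1 <= k < d.+1) #|wrap_class H k|%:R *: 'X^k in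
    [/\ forall k, (1 <= k <= d)%N -> (0 < #|wrap_class H k|)%N, mup 0 p = 1%N
      & exists rs : seq R, [/\ size rs = (d - 1)%N, uniq rs
          & forall x, x \in rs -> x < 0 /\ root p x]].
Proof.
move=> d_gt0; have [t [t_neg t_decr t_sign]] := eulerian_alternates R d_gt0.
have f_gt0 : (0 : R) < (d`!)%:R by rewrite ltr0n fact_gt0.
pose E i := (-1) ^+ i.+1 * \sum_(s <- permutations (iota 0 d)) t i ^+ (descents s).+1.
(* For precision eps the value at t_i is off by at most
#|H| / d! * (eps * c i), and the Eulerian polynomial has modulus E i there. *)
pose c i := (d`!)%:R ^+ 2 * \sum_(1 <= k < d.+1) `|t i ^+ k|.
have c_ge0 i : 0 <= c i by rewrite mulr_ge0 ?exprn_ge0 ?(ltW f_gt0) ?sumr_ge0.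
have [|eps /andP[eps_gt0 eps_lt] epsP] := exists_small_multiplier c
  (_ : 0 < (d`!)%:R^-1 :> R) (t_sign : forall i, (i < d)%N -> 0 < E i).
  by rewrite invr_gt0.
have [D DP] := chamber_equidistribution d eps_gt0; exists D => m H Hsub Hnt.
have lower := DP m H Hsub Hnt.
have H_gt0 : (0 : R) < #|H|%:R.
  by rewrite ltr0n; apply/card_gt0P; exists 0; case: Hsub.
have wrap_class_gt0 k : (1 <= k <= d)%N -> (0 < #|wrap_class H k|)%N.
  case: k => // k /= lt_k; have [s ps ds] := exists_permutation_descents lt_k.
  apply: (@leq_trans #|chamber H s|).
    rewrite -(ltr0n R); apply: lt_le_trans (lower s ps).
    by rewrite mulr_gt0 // subr_gt0.
  by rewrite subset_leq_card // -ds chamber_sub_wrap_class.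
move=> p; split=> //.
  apply: (mup0_eq1 d_gt0 (c := fun k => #|wrap_class H k|%:R)) => //.
  by rewrite pnatr_eq0 -lt0n wrap_class_gt0.
have p_sign i : (i < d)%N -> 0 < (-1) ^+ i.+1 * p.[t i].
  move=> lt_i; set N : R := #|H|%:R in H_gt0 *.
  have close : `|p.[t i] - N / (d`!)%:R *
      \sum_(s <- permutations (iota 0 d)) t i ^+ (descents s).+1|
      <= N / (d`!)%:R * (eps * c i).
    rewrite sum_eulerian // /p horner_sum mulr_sumr -sumrB.
    apply: (le_trans (ler_norm_sum _ _ _)).
    rewrite /c !mulr_sumr; apply: ler_sum => k _.
    rewrite hornerZ hornerXn mulrA -mulrBl normrM !mulrA ler_wpM2r //.
    have := card_wrap_class_approx k d_gt0 (ltW eps_gt0) lower; rewrite -/N.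
    by congr (`|_ - _| <= _); field; rewrite lt0r_neq0.
  have sgn1 x : `|x| = `|(-1) ^+ i.+1 * x| :> R by rewrite normrM normrX normrN1 expr1n mul1r.
  have Nf : 0 < N / (d`!)%:R by rewrite divr_gt0.
  have := epsP i lt_i; rewrite ger0_norm // -(ltr_pM2l Nf).
  move: close; rewrite sgn1 mulrBr ler_norml (mulrCA ((-1) ^+ i.+1) (N / _)) -/(E i).
  move=> /andP[lo _] hi.
  by lra.
have [|i|rs [size_rs uniq_rs rsP]] := @alternating_roots R p (d - 1) t.
- by move=> i lt_i; apply: t_decr; lia.
- by move=> le_i; apply: p_sign; lia.
exists rs; split=> // x /rsP[xt px]; split=> //.
by apply: (lt_trans xt); exact: t_neg.
Qed.

(** * The torus subgroup of a lattice simplex *)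

(** If Y_i are the partial sums of the coefficients l_i, summation by parts turns
the sum of the l_i v_i into the sum of the Y_i (v_i - v_(i+1)) plus an
integral multiple of v_d. *)
Definition edge_mx (d : nat) (v : 'I_d.+1 -> 'rV[int]_d) : 'M[int]_d :=
  \matrix_(i, j) (v (widen_ord (leqnSn d) i) 0 j - v (lift ord0 i) 0 j).

Lemma sum_by_parts (V : pzRingType) (d : nat) (c : nat -> V) (a : 'I_d.+1 -> V) :
  \sum_(i < d.+1) (c i.+1 - c i) * a i
  = \sum_(i < d) c i.+1 * (a (widen_ord (leqnSn d) i) - a (lift ord0 i))
    + c d.+1 * a ord_max - c 0%N * a ord0.
Proof.
under eq_bigr do rewrite mulrBl; under [in RHS]eq_bigr do rewrite mulrBr.
rewrite !sumrB big_ord_recr [X in _ - X]big_ord_recl /=.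
by rewrite opprD addrA addrAC; congr (_ - _); rewrite addrAC.
Qed.

(** The y in (Z/(m+1))^d such that y / (m + 1) times the edge matrix is integral.
For m + 1 = |det|, these y / (m + 1) are all the points of the torus with that
property. *)
Definition edge_group (d : nat) (v : 'I_d.+1 -> 'rV[int]_d) (m : nat) :
    {set {ffun 'I_d -> 'I_m.+1}} :=
  [set y : {ffun 'I_d -> 'I_m.+1} |
    [forall j, (m.+1 %| \sum_i (y i : int) * edge_mx v i j)%Z]].

Lemma ord_modz (m : nat) (x : int) :
  exists y : 'I_m.+1, (m.+1 %| x - (y : int))%Z.
Proof.
have := modz_ge0 x (d := m.+1) isT; have := ltz_pmod x (d := m.+1) isT.
have := divz_eq x m.+1; case: (x %% _)%Z => // r xE r_lt _.
have lt_r : (r < m.+1)%N by [].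
exists (Ordinal lt_r); apply/dvdzP; exists (x %/ m.+1)%Z.
by rewrite {1}xE addrK.
Qed.

(** Membership may be tested on any integers congruent to the coordinates. *)
Lemma edge_groupP (d : nat) (v : 'I_d.+1 -> 'rV[int]_d) (m : nat)
    (y : {ffun 'I_d -> 'I_m.+1}) (x : 'I_d -> int) :
  (forall i, (m.+1 %| x i - (y i : int))%Z) ->
  (y \in edge_group v m) = [forall j, (m.+1 %| \sum_i x i * edge_mx v i j)%Z].
Proof.
move=> xy; rewrite inE; apply: eq_forallb => j.
have dxy : (m.+1 %| \sum_i (x i - (y i : int)) * edge_mx v i j)%Z.
  by apply: rpred_sum => i _; rewrite dvdz_mulr.
have -> : \sum_i x i * edge_mx v i j
    = \sum_i (y i : int) * edge_mx v i j + \sum_i (x i - (y i : int)) * edge_mx v i j.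
  by rewrite -big_split /=; apply: eq_bigr => i _; rewrite -mulrDl addrC subrK.
by rewrite rpredDr.
Qed.

Lemma dvdz_ord_add (m : nat) (a b : 'I_m.+1) :
  (m.+1 %| (a : int) + (b : int) - ((a + b)%R : int))%Z.
Proof.
apply/dvdzP; exists (((a + b) %/ m.+1)%N : int) => /=.
by rewrite -PoszD {1}(divn_eq (a + b) m.+1) PoszD PoszM addrK.
Qed.

Lemma zmod_closed_edge_group (d : nat) (v : 'I_d.+1 -> 'rV[int]_d) (m : nat) :
  zmod_closed (edge_group v m).
Proof.
split=> [|y z yH zH].
  by rewrite inE; apply/forallP => j; rewrite big1 // => i _; rewrite ffunE mul0r.
rewrite (@edge_groupP _ _ _ _ (fun i => (y i : int) - (z i : int))).
  move: yH zH; rewrite !inE => /forallP yH /forallP zH; apply/forallP => j.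
  under eq_bigr do rewrite mulrBl.
  by rewrite sumrB rpredB.
move=> i; have := dvdz_ord_add ((y - z) i) (z i).
have -> : (y - z) i + z i = y i by rewrite !ffunE subrK.
rewrite -rpredN; have -> : - ((((y - z) i : int) + (z i : int)) - (y i : int))
    = (y i : int) - (z i : int) - ((y - z) i : int) by ring.
by [].
Qed.

Section Simplex.
Variables (R : realType) (d : nat) (v : 'I_d.+1 -> 'rV[int]_d).
Hypothesis v_free : affinely_independent (fun i => lattice_point (v i) : 'rV[R]_d).

Lemma det_edge_mx_neq0 : \det (edge_mx v) != 0.
Proof.
apply/negP => det0.
have /det0P[c c_neq0 cB] : \det (map_mx intr (edge_mx v) : 'M[R]_d) == 0.
  by rewrite det_map_mx (eqP det0).
(* The differences of the sequence 0, c_0, ..., c_(d-1), 0 are the coefficients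
of an affine dependence between the vertices. *)
pose C (i : nat) : R := if i is j.+1 then (if insub j is Some j' then c 0 j' else 0) else 0.
have C_S (i : 'I_d) : C i.+1 = c 0 i by rewrite /C valK.
have C_last : C d.+1 = 0 by rewrite /C insubF // ltnn.
have C_step (i : 'I_d.+1) : C i.+1 - C i = 0.
  apply: (v_free (c := fun i : 'I_d.+1 => C i.+1 - C i)).
    rewrite -(big_mkord xpredT (fun i => C i.+1 - C i)) telescope_sumr //.
    by rewrite C_last subr0.
  apply/rowP => j; rewrite summxE mxE.
  under eq_bigr do rewrite mxE.
  rewrite (sum_by_parts C) C_last !mul0r addr0 subr0.
  transitivity ((c *m map_mx intr (edge_mx v)) 0 j); last by rewrite cB mxE.
  by rewrite mxE; apply: eq_bigr => k _; rewrite C_S !mxE rmorphB.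
have C0 i : (i <= d.+1)%N -> C i = 0.
  elim: i => // i IH lt_i; have := C_step (Ordinal lt_i); rewrite /= IH ?subr0 //.
  exact: ltnW.
move/eqP: c_neq0; apply; apply/rowP => i.
by rewrite mxE -C_S C0 // ltnS ltnW.
Qed.

End Simplex.

Local Open Scope classical_set_scope.

(** * Lattice width and linear functionals *)

Section LatticeFunctional.
Variables (R : realType) (d : nat) (w : 'cV[int]_d).

Definition lattice_functional (x : 'rV[R]_d) : R := \sum_j x 0 j * (w j 0)%:~R.

Lemma lattice_functional_is_linear : scalar lattice_functional.
Proof.
move=> a x y; rewrite /lattice_functional mulr_sumr -big_split /=.
by apply: eq_bigr => j _; rewrite !mxE mulrDl mulrA.
Qed.

HB.instance Definition _ := GRing.isLinear.Build R 'rV[R]_d R _ lattice_functional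
  lattice_functional_is_linear.

Lemma lattice_functionalE (z : 'rV[int]_d) :
  lattice_functional (lattice_point z) = (\sum_j z 0 j * w j 0)%:~R.
Proof.
rewrite rmorph_sum; apply: eq_bigr => j _.
by rewrite mxE rmorphM.
Qed.

End LatticeFunctional.

(** A slab containing the vertices is convex, hence contains the simplex. *)
Lemma simplex_functional_bounds (R : realType) (d : nat)
    (v : 'I_d.+1 -> 'rV[int]_d) (f : {scalar 'rV[R]_d}) (a b : R) :
  (forall i, a <= f (lattice_point (v i)) <= b) ->
  forall x, simplex R v x -> a <= f x <= b.
Proof.
move=> fv x; apply: (smallest_sub (X := [set x | a <= f x <= b])).
  move=> y z t; rewrite !inE /= => /andP[ay yb] /andP[az zb].
  have [t0 t1] : 0 <= t%:num /\ t%:num <= 1 by split.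
  rewrite -[conv _ _ _]/(t%:num *: (y : 'rV[R]_d) + (1 - t%:num) *: (z : 'rV[R]_d)).
  rewrite linearD !linearZ /= /unstable.onem; apply/andP; split; nra.
by move=> _ [i _ <-]; exact: fv.
Qed.

(** The infimum of a set without lower bound is 0 by convention, so the
hypothesis that the width is positive says that it is a true infimum. *)
Lemma width_le (R : realType) (d : nat) (v : 'I_d.+1 -> 'rV[int]_d)
    (f : {scalar 'rV[R]_d}) (a b : R) :
  dual_lattice f -> (exists x, f x != 0) ->
  (forall i, a <= f (lattice_point (v i)) <= b) ->
  0 < width (simplex R v) -> width (simplex R v) <= b - a.
Proof.
move=> f_dual f_neq0 fv; rewrite /width; set E := (X in inf X) => width_gt0.
have E_inf : has_inf E.
  by apply: contrapT => /inf_out E0; rewrite E0 ltxx in width_gt0.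
apply: (@le_trans _ _ (sup [set f x | x in simplex R v] - inf [set f x | x in simplex R v])).
  by apply: ge_inf; [exact: (proj2 E_inf) | exists f].
have nonempty : [set f x | x in simplex R v] !=set0.
  exists (f (lattice_point (v ord0))); exists (lattice_point (v ord0)) => //.
  by apply: sub_gen_smallest; exists ord0.
apply: lerB.
  apply: ge_sup => // _ [x xS <-].
  by have /andP[] := simplex_functional_bounds fv xS.
apply: lb_le_inf => // _ [x xS <-].
by have /andP[] := simplex_functional_bounds fv xS.
Qed.

(** The rows of the adjugate of B are congruent to elements of the group, because
\adj B * B = \det B.  So m + 1 = |\det B| divides \adj B * k, and multiplying the
quotient by B gives back k up to sign. *)
Lemma edge_group_annihilator (d : nat) (v : 'I_d.+1 -> 'rV[int]_d) (m : nat)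
    (k : 'I_d -> int) :
  m.+1 = `|\det (edge_mx v)|%N ->
  (forall h, h \in edge_group v m -> (m.+1 %| \sum_i k i * (h i : int))%Z) ->
  exists w : 'cV[int]_d, forall i, k i = \sum_j edge_mx v i j * w j 0.
Proof.
move=> mE ann; set B := edge_mx v in mE *.
have det_m : (m.+1 %| \det B)%Z by rewrite mE dvdzE.
have adj_dvd a : (m.+1 %| \sum_i \adj B a i * k i)%Z.
  have [h hE] := choice (fun i => ord_modz m (\adj B a i)).
  pose y := [ffun i => h i].
  have yE i : (m.+1 %| \adj B a i - (y i : int))%Z by rewrite ffunE.
  have /ann kh : y \in edge_group v m.
    rewrite (edge_groupP v yE); apply/forallP => j.
    have := congr1 (fun M : 'M[int]_d => M a j) (mul_adj_mx B).
    rewrite /= !mxE => ->; exact: rpredMn.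
  have -> : \sum_i \adj B a i * k i
      = \sum_i k i * (y i : int) + \sum_i k i * (\adj B a i - (y i : int)).
    by rewrite -big_split /=; apply: eq_bigr => i _; ring.
  by rewrite rpredD // rpred_sum // => i _; rewrite dvdz_mull.
have [w wE] := choice (fun a => elimT dvdzP (adj_dvd a)).
pose K : 'cV[int]_d := \col_i k i.
have adjK : \adj B *m K = m.+1%:Z *: \col_a w a.
  apply/colP => a; rewrite [LHS]mxE [RHS]mxE [in RHS]mxE mulrC -wE.
  by apply: eq_bigr => i _; congr (_ * _); rewrite mxE.
have detK : \det B *: K = m.+1%:Z *: (B *m \col_a w a).
  by rewrite -mul_scalar_mx -mul_mx_adj -mulmxA adjK scalemxAr.
pose e := Num.sg (\det B).
have KE : K = B *m (e *: \col_a w a).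
  have m_eq : m.+1%:Z = e * \det B by rewrite mE abszE normrEsg.
  have E : m.+1%:Z *: K = m.+1%:Z *: (B *m (e *: \col_a w a)).
    by rewrite [in LHS]m_eq -scalerA detK -scalemxAr !scalerA mulrC.
  apply/colP => i; apply: (mulfI (isT : m.+1%:Z != 0)).
  by have := congr1 (fun M : 'cV[int]_d => M i 0) E; rewrite !mxE.
exists (e *: \col_a w a) => i.
by have := congr1 (fun M : 'cV[int]_d => M i 0) KE; rewrite /= !mxE.
Qed.

(** If k = B w is annihilated by the group, the functional w changes by k_i from
v_i to v_(i+1), hence by at most d (D + 1) from v_0 to any vertex; this bounds
the width by twice that amount, unless w = 0 and then k = 0. *)
Lemma wide_simplex_no_small_annihilator (R : realType) (d D : nat)
    (v : 'I_d.+1 -> 'rV[int]_d) (m : nat) :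
  m.+1 = `|\det (edge_mx v)|%N ->
  (d * D.+1).*2%:R < width (simplex R v) ->
  no_small_annihilator D.+1 (edge_group v m).
Proof.
move=> mE wide k k_small [i0 k_neq0]; apply: contrapT => no_h.
have [|w wE] := edge_group_annihilator (k := k) mE.
  by move=> h hH; apply: contrapT => /negP nk; apply: no_h; exists h.
pose f : {scalar 'rV[R]_d} := @lattice_functional R d w.
pose g (i : 'I_d.+1) : int := \sum_j v i 0 j * w j 0.
have fE i : f (lattice_point (v i)) = (g i)%:~R by rewrite /f /= lattice_functionalE.
have gk (i : 'I_d) : g (widen_ord (leqnSn d) i) - g (lift ord0 i) = k i.
  by rewrite wE -sumrB; apply: eq_bigr => j _; rewrite !mxE -mulrBl.
have g_bound n (lt_n : (n < d.+1)%N) : `|g (Ordinal lt_n) - g ord0| <= (n * D.+1)%:Z.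
  elim: n lt_n => [|n IH] lt_n.
    by rewrite (_ : Ordinal lt_n = ord0) ?subrr ?normr0 //; apply: val_inj.
  have lt_n' : (n < d)%N by [].
  have := gk (Ordinal lt_n'); have := k_small (Ordinal lt_n').
  rewrite (_ : widen_ord _ _ = Ordinal (ltnW lt_n)); last exact: val_inj.
  rewrite (_ : lift ord0 _ = Ordinal lt_n); last exact: val_inj.
  by have := IH (ltnW lt_n); rewrite mulSn; lia.
have {}g_bound i : `|g i - g ord0| <= (d * D.+1)%:Z.
  case: i => n lt_n; apply: (le_trans (g_bound n lt_n)).
  by rewrite lez_nat leq_mul2r -ltnS lt_n orbT.
have : width (simplex R v) <= ((d * D.+1).*2)%:R.
  pose a : R := (g ord0 - (d * D.+1)%:Z)%:~R; pose b : R := (g ord0 + (d * D.+1)%:Z)%:~R.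
  rewrite (_ : _%:R = b - a); last first.
    by rewrite -rmorphB pmulrn; congr _%:~R; rewrite -addnn; lia.
  apply: (@width_le _ _ _ f).
  - move=> z; rewrite /f /= lattice_functionalE; exact: intr_int.
  - apply: contrapT => f0; move/eqP: k_neq0; apply; rewrite -gk; apply/eqP.
    have f0' i : f (lattice_point (v i)) = 0.
      by apply/eqP; apply: contrapT => /negP fx; apply: f0; exists (lattice_point (v i)).
    rewrite -(intr_eq0 R) rmorphB /= -!fE !f0' subrr //.
  - by move=> i; rewrite fE !ler_int; have := g_bound i; lia.
  - by apply: le_lt_trans wide.
by rewrite leNgt wide.
Qed.

(** * Lattice points of the open parallelepiped *)

Lemma sum_row_mx1 (R : pzRingType) (d n : nat) (c : 'I_n -> R) (p : 'I_n -> 'rV[R]_d) :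
  \sum_i c i *: row_mx (p i) 1%:M
  = row_mx (\sum_i c i *: p i) (\sum_i c i)%:M :> 'rV[R]_(d + 1).
Proof.
rewrite -[LHS]hsubmxK; congr row_mx; rewrite linear_sum.
  by apply: eq_bigr => i _; rewrite linearZ /= row_mxKl.
rewrite [RHS]raddf_sum; apply: eq_bigr => i _.
by rewrite linearZ /= row_mxKr scale_scalar_mx mulr1.
Qed.

Section Slices.
Variables (R : realType) (d : nat) (v : 'I_d.+1 -> 'rV[int]_d) (m : nat).

(** The advance of the walk at step i, as a fraction of a full turn. *)
Definition barycentric (y : {ffun 'I_d -> 'I_m.+1}) (i : 'I_d.+1) : R :=
  ((corner y i.+1)%:R - (corner y i)%:R) / m.+1%:R
    + (corner y i.+1 < corner y i)%N%:R.

Definition cone_point (y : {ffun 'I_d -> 'I_m.+1}) : 'rV[R]_(d + 1) :=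
  \sum_i barycentric y i *: row_mx (lattice_point (v i)) 1%:M.

Lemma sum_barycentric y : \sum_i barycentric y i = (wraps y)%:R.
Proof.
rewrite big_split /= -mulr_suml natr_sum -[RHS]add0r; congr (_ + _).
rewrite -(big_mkord xpredT (fun i => (corner y i.+1)%:R - (corner y i)%:R)).
by rewrite telescope_sumr // corner_last subrr mul0r.
Qed.

Lemma barycentric_bounds y (i : 'I_d.+1) :
  corner y i.+1 != corner y i -> 0 < barycentric y i < 1.
Proof.
have m0 : (0 : R) < m.+1%:R by rewrite ltr0n.
have := corner_le y i; have := corner_le y i.+1.
rewrite /barycentric; move: (corner y i.+1) (corner y i) => a b am bm.
have am' : a%:R < m.+1%:R :> R by rewrite ltr_nat ltnS.
have bm' : b%:R < m.+1%:R :> R by rewrite ltr_nat ltnS.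
have a0 : (0 : R) <= a%:R by [].
have b0 : (0 : R) <= b%:R by [].
case: (ltngtP a b) => // [ab|ba] _.
  have abR : a%:R < b%:R :> R by rewrite ltr_nat.
  have -> : (a%:R - b%:R) / m.+1%:R + 1 = (a%:R - b%:R + m.+1%:R) / m.+1%:R :> R.
    by rewrite [RHS]mulrDl divff ?lt0r_neq0.
  by rewrite divr_gt0 ?ltr_pdivrMr //=; lra.
have baR : b%:R < a%:R :> R by rewrite ltr_nat.
by rewrite addr0 divr_gt0 ?ltr_pdivrMr //=; lra.
Qed.

Lemma barycentric_inj (y z : {ffun 'I_d -> 'I_m.+1}) :
  (forall i, barycentric y i = barycentric z i) -> y = z.
Proof.
move=> yz; have m0 : (0 : R) < m.+1%:R by rewrite ltr0n.
have yzc i : (i <= d.+1)%N -> corner y i = corner z i.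
  elim: i => // i IH lt_i; have := yz (Ordinal lt_i); rewrite /barycentric /=.
  rewrite (IH (ltnW lt_i)).
  have := corner_le y i.+1; have := corner_le z i.+1.
  move: (corner y i.+1) (corner z i.+1) (corner z i) => a a' b am am'.
  move/(congr1 (fun x => x * m.+1%:R)); rewrite !mulrDl !divfK ?lt0r_neq0 //.
  move=> E; suff : a%:Z - a'%:Z = (a' < b)%N%:Z * m.+1%:Z - (a < b)%N%:Z * m.+1%:Z.
    by case: (a < b)%N; case: (a' < b)%N; lia.
  apply: (@intr_inj R); rewrite !(rmorphB, rmorphM) /= -!pmulrn; lra.
apply/ffunP => i; apply: val_inj => /=.
by rewrite -!cornerS yzc // ltnS ltnW.
Qed.

Lemma cone_pointE (y : {ffun 'I_d -> 'I_m.+1}) :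
  y \in edge_group v m ->
  exists z : 'rV[int]_d, cone_point y = row_mx (lattice_point z) (wraps y)%:R%:M.
Proof.
rewrite inE => /forallP yH; rewrite /cone_point sum_row_mx1 sum_barycentric.
have m0 : (0 : R) < m.+1%:R by rewrite ltr0n.
have [q qE] := choice (fun j => elimT dvdzP (yH j)).
exists (\row_j (q j + \sum_(i < d.+1) (corner y i.+1 < corner y i)%N%:Z * v i 0 j)).
congr row_mx; apply/rowP => j; rewrite summxE !mxE rmorphD rmorph_sum /=.
under eq_bigr do rewrite !mxE mulrDl mulrAC.
rewrite big_split /= -mulr_suml; congr (_ + _); last first.
  by apply: eq_bigr => i _; rewrite rmorphM.
rewrite (sum_by_parts (fun i => (corner y i)%:R) (fun i => (v i 0 j)%:~R)).
rewrite corner_last !mul0r addr0 subr0.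
apply: (canLR (mulfK (lt0r_neq0 m0))).
rewrite -[m.+1%:R]/(m.+1%:Z%:~R) -rmorphM -qE rmorph_sum.
by apply: eq_bigr => i _; rewrite cornerS mxE rmorphM rmorphB.
Qed.

Hypothesis mE : m.+1 = `|\det (edge_mx v)|%N.

(** The partial sums S of lam satisfy S B = z - k v_d, an integral vector, so by
Cramer's rule their multiples N by |\det B| are integers.  Reduced modulo m + 1,
the N_i are the corners of a walk; as lam_i lies in ]0, 1[, the i-th step of
the walk is not stationary and its advance is lam_i. *)
Lemma barycentric_surj (lam : 'I_d.+1 -> R) (k : nat) (z : 'rV[int]_d) :
  (forall i, 0 < lam i < 1) -> \sum_i lam i = k%:R ->
  \sum_i lam i *: lattice_point (v i) = lattice_point z ->
  exists2 y, y \in wrap_class (edge_group v m) k & forall i, lam i = barycentric y i.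
Proof.
move=> lam01 lam_sum lam_z; have m0 : (0 : R) < m.+1%:R by rewrite ltr0n.
pose l (i : nat) : R := lam (inord i).
pose S (n : nat) : R := \sum_(i < n) l i.
have S_step (i : 'I_d.+1) : S i.+1 - S i = lam i.
  by rewrite /S big_ord_recr /= addrAC subrr add0r /l inord_val.
have S0 : S 0%N = 0 by rewrite /S big_ord0.
have Sd : S d.+1 = k%:R.
  by rewrite -lam_sum; apply: eq_bigr => i _; rewrite /l inord_val.
have SB j : \sum_(i < d) S i.+1 * (edge_mx v i j)%:~R
    = (z 0 j - k%:Z * v ord_max 0 j)%:~R.
  have := congr1 (fun x : 'rV[R]_d => x 0 j) lam_z; rewrite /= summxE mxE => Ez.
  rewrite rmorphB /= -Ez rmorphM /=.
  under [in RHS]eq_bigr do rewrite !mxE -S_step.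
  rewrite (sum_by_parts S (fun i => (v i 0 j)%:~R)) S0 Sd mul0r subr0 addrK.
  by apply: eq_bigr => i _; rewrite mxE rmorphB.
have NE i : exists N : int, (i <= d.+1)%N -> m.+1%:R * S i = N%:~R.
  case: (ltnP i d.+1) => [lt_i|ge_i]; last first.
    exists (m.+1%:Z * k%:Z) => le_i; have -> : i = d.+1 by lia.
    by rewrite Sd rmorphM.
  case: i lt_i => [|i] lt_i; first by exists 0; rewrite S0 mulr0.
  pose s : 'rV[R]_d := \row_i S i.+1.
  pose zk : 'rV[int]_d := \row_j (z 0 j - k%:Z * v ord_max 0 j).
  have sB : s *m map_mx intr (edge_mx v) = map_mx intr zk.
    apply/rowP => j; rewrite mxE [RHS]mxE [in RHS]mxE -SB.
    by apply: eq_bigr => a _; rewrite !mxE.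
  have s_det : (\det (edge_mx v))%:~R *: s = map_mx intr (zk *m \adj (edge_mx v)).
    rewrite map_mxM -sB -mulmxA map_mx_adj mul_mx_adj det_map_mx.
    by rewrite mul_mx_scalar.
  pose i' := Ordinal (lt_i : (i < d)%N).
  exists (Num.sg (\det (edge_mx v)) * (zk *m \adj (edge_mx v)) 0 i') => _.
  have := congr1 (fun x : 'rV[R]_d => x 0 i') s_det; rewrite /= [LHS]mxE [in LHS]mxE.
  rewrite [RHS]mxE => E; rewrite rmorphM /= -E mulrA -rmorphM -normrEsg -abszE -mE.
  by rewrite /= -pmulrn.
have [N NP] := choice NE.
have [y0 y0E] := choice (fun i : 'I_d => ord_modz m (N i.+1)).
pose y := [ffun i => y0 i].
have N0 : N 0%N = 0.
  by apply/eqP; rewrite -(intr_eq0 R) -NP // S0 mulr0.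
have Nd : N d.+1 = m.+1%:Z * k%:Z.
  by apply: (@intr_inj R); rewrite -NP // Sd rmorphM.
have cN i : (i <= d.+1)%N -> (m.+1 %| N i - (corner y i)%:Z)%Z.
  case: i => [|i] le_i; first by rewrite N0.
  case: (ltnP i d) => [lt_i|ge_i].
    by rewrite (cornerS y (Ordinal lt_i)) ffunE; exact: (y0E (Ordinal lt_i)).
  have -> : i = d by lia.
  by rewrite corner_last Nd subr0 dvdz_mulr.
have N_step (i : 'I_d.+1) : m.+1%:R * lam i = (N i.+1 - N i)%:~R.
  by rewrite -S_step mulrBr rmorphB /= -!NP // ltnW.
have cases (i : 'I_d.+1) : corner y i.+1 != corner y i /\
    N i.+1 - N i = (corner y i.+1)%:Z - (corner y i)%:Z
      + m.+1%:Z * (corner y i.+1 < corner y i)%N%:Z.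
  have /andP[l0 l1] := lam01 i.
  have N_gt0 : 0 < N i.+1 - N i.
    by rewrite -(ltr0z R) -N_step mulr_gt0.
  have N_lt : N i.+1 - N i < m.+1.
    by rewrite -(ltr_int R) -N_step -pmulrn gtr_pMr.
  have := cN i.+1 (ltn_ord i); have := cN i (ltnW (ltn_ord i)).
  have := corner_le y i; have := corner_le y i.+1.
  move: (N i.+1) (N i) (corner y i.+1) (corner y i) N_gt0 N_lt => P Q a b.
  move=> PQ0 PQm am bm /dvdzP[q1 E1] /dvdzP[q2 E2].
  have E : P - Q = a%:Z - b%:Z + (q2 - q1) * m.+1 by lia.
  (* a - b and the step lie in ]-(m+1), m+1[ and ]0, m+1[ respectively. *)
  have q_cases : q2 - q1 = 0 \/ q2 - q1 = 1.
    have : -1 < q2 - q1 by nia.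
    have : q2 - q1 < 2 by nia.
    lia.
  by case: q_cases => q_eq; rewrite q_eq in E; split; case: (ltngtP a b) => ab; lia.
exists y; last first.
  move=> i; have [_ E] := cases i.
  apply: (mulfI (lt0r_neq0 m0)); rewrite N_step E /barycentric.
  rewrite mulrDr mulrCA divff ?lt0r_neq0 // mulr1.
  by rewrite rmorphD rmorphB rmorphM.
have wraps_k : wraps y = k.
  apply/eqP; rewrite -(eqr_nat R) -sum_barycentric -lam_sum; apply/eqP.
  apply: eq_bigr => i _; have [_ E] := cases i.
  apply: (mulfI (lt0r_neq0 m0)); rewrite N_step E /barycentric.
  rewrite mulrDr mulrCA divff ?lt0r_neq0 // mulr1.
  by rewrite rmorphD rmorphB rmorphM.
rewrite inE wraps_k eqxx andbT; apply/andP; split; last first.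
  by apply/forallP => i; have [] := cases i.
rewrite (@edge_groupP _ _ _ _ (fun i => N i.+1)).
  apply/forallP => j; apply/dvdzP; exists (z 0 j - k%:Z * v ord_max 0 j).
  apply: (@intr_inj R); rewrite rmorphM /= -SB mulr_suml rmorph_sum.
  by apply: eq_bigr => i _; rewrite rmorphM /= -NP ?ltnS ?(ltnW (ltn_ord i)) //; ring.
by move=> i; rewrite ffunE.
Qed.

Hypothesis v_free : affinely_independent (fun i => lattice_point (v i) : 'rV[R]_d).

Lemma cone_point_inj : injective cone_point.
Proof.
move=> y z yz; apply: barycentric_inj => i; apply/eqP; rewrite -subr_eq0; apply/eqP.
move: yz; rewrite /cone_point !sum_row_mx1 => /eq_row_mx[yz1 yz2].
move: i; apply: v_free.
  rewrite sumrB; apply/eqP; rewrite subr_eq0; apply/eqP.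
  by have := congr1 (fun x : 'M[R]_1 => x 0 0) yz2; rewrite /= !mxE.
by under eq_bigr do rewrite scalerBl; rewrite sumrB yz1 subrr.
Qed.

Lemma local_hstar_coef_wrap_class k :
  local_hstar_coef R v k = #|wrap_class (edge_group v m) k|.
Proof.
rewrite /local_hstar_coef.
have -> : open_parallelepiped_slice v k `&` lattice_points_at_height k
    = [set` [fset cone_point y | y in wrap_class (edge_group v m) k]%fset].
  apply/seteqP; split=> x /=.
    move=> [[lam [lam01 lam_sum] <-] [z _]]; rewrite sum_row_mx1.
    move=> /eq_row_mx[lam_z _].
    have [y yS lamE] := barycentric_surj lam01 lam_sum (esym lam_z).
    apply/imfsetP; exists y => //=.
    rewrite /cone_point sum_row_mx1; under eq_bigr do rewrite lamE.
    by under [in X in row_mx _ X]eq_bigr do rewrite lamE.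
  move=> /imfsetP[y /= + ->]; rewrite inE => /and3P[yH /forallP y_steps /eqP wk].
  split; last by have [z ->] := cone_pointE yH; exists z => //; rewrite wk.
  exists (barycentric y) => //; split; last by rewrite sum_barycentric wk.
  by move=> i; apply: barycentric_bounds.
rewrite set_fsetK card_imfset /=; last exact: cone_point_inj.
by rewrite -cardE.
Qed.

End Slices.

(** * Lattice simplices of large width *)

Theorem theorem1p2 (R : realType) (d : nat) (d_gt0 : (0 < d)%N) :
  exists C : R, 0 < C /\
    forall v : 'I_d.+1 -> 'rV[int]_d,
      affinely_independent (fun i => lattice_point (v i) : 'rV[R]_d) ->
      C < width (simplex R v) ->
      [/\ forall k : nat, (1 <= k <= d)%N -> (0 < local_hstar_coef R v k)%N,
          mup 0 (local_hstar R v) = 1%N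
        & exists rs : seq R,
            [/\ size rs = (d - 1)%N, uniq rs
              & forall x, x \in rs -> x < 0 /\ root (local_hstar R v) x]].
Proof.
have [D DP] := wrap_polynomial_roots R d_gt0.
exists (d * D.+1).*2%:R; split; first by rewrite ltr0n double_gt0 muln_gt0 d_gt0.
move=> v v_free wide.
pose m := `|\det (edge_mx v)|%N.-1.
have mE : m.+1 = `|\det (edge_mx v)|%N.
  by rewrite prednK // absz_gt0; exact: det_edge_mx_neq0 v_free.
have := DP m _ (zmod_closed_edge_group v m) (wide_simplex_no_small_annihilator mE wide).
have coefE k := local_hstar_coef_wrap_class mE v_free k.
rewrite (_ : \sum_(1 <= k < d.+1) _ = local_hstar R v); last first.
  by apply: eq_bigr => k _; rewrite coefE.
by move=> [pos mup rs]; split=> // k /pos; rewrite coefE.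
Qed.
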